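(* For $p,q>0$, the function $$\Phi_{p,q}(t)=\frac{2^{it/p}\,\Gamma((1+it)/p)\,\Gamma(1/q)}{2^{it/q}\,\Gamma((1+it)/q)\,\Gamma(1/p)},\qquad t\in\mathbb{R},$$ is a characteristic function (of a real random variable) if and only if $p\le q$. If $p<q$, then $\Phi_{p,q}$ is the characteristic function of $$\log V_{p,q}=\left(\frac1p-\frac1q\right)\log 2+\log W,\qquad W=\left(S_{p/q}^{-1/q}\right)^*,$$ where the star denotes ordinary size-biasing of the positive random variable $S_{p/q}^{-1/q}$ and $S_{p/q}$ is positive $(p/q)$-stable. If $p=q$, then $\Phi_{p,p}\equiv1$.
   Context: Positive $\alpha$-stable: for $0<\alpha<1$, $S_\alpha$ is the positive random variable with Laplace transform $\mathbb{E}e^{-uS_\alpha}=e^{-u^\alpha}$ for all $u\ge0$. Size-biasing: if $Y\ge0$ with $0<\mathbb{E}Y<\infty$, the $Y$-size-biased version $Y^*$ of $Y$ is a positive random variable with law $\mathbb{P}(Y^*\in A)=\mathbb{E}[Y\mathbf{1}_{\{Y\in A\}}]/\mathbb{E}Y$ for Borel sets $A\subseteq[0,\infty)$. (The variable $S_{p/q}^{-1/q}$ has finite positive mean.) For $p<q$, $V_{p,q}$ denotes the positive random variable $V_{p,q}=2^{1/p-1/q}W$ with $W=(S_{p/q}^{-1/q})^*$. For $c\in\{p,q\}$, $2^{it/c}=e^{i(t/c)\log 2}$. *)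

(* Defs.v *)
From HB Require Import structures.
From mathcomp Require Import all_boot all_order all_algebra.
From mathcomp Require Import all_classical all_reals all_analysis.
From mathcomp Require Import complex.

Set Implicit Arguments.
Unset Strict Implicit.
Unset Printing Implicit Defensive.
Import Order.TTheory GRing.Theory Num.Theory.
Import numFieldNormedType.Exports.

Local Open Scope classical_set_scope.
Local Open Scope ring_scope.
Local Open Scope complex_scope.

Definition cexp (R : realType) (z : R[i]) : R[i] :=
  (expR (complex.Re z))%:C * (cos (complex.Im z) +i* sin (complex.Im z)).

(* x ^ z = exp (z log x); meaningful for a positive base x. *)
Definition cpow (R : realType) (x : R) (z : R[i]) : R[i] :=
  cexp (z * (ln x)%:C).

(* Meaningful when the real and imaginary parts of f are both integrable,
   since [fine] sends infinite values to 0. *)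
Definition cintegral d (T : measurableType d) (R : realType)
    (mu : {measure set T -> \bar R}) (D : set T) (f : T -> R[i]) : R[i] :=
  (\int[mu]_(x in D) complex.Re (f x)) +i*
  (\int[mu]_(x in D) complex.Im (f x)).

(* Euler's integral; meaningful on the half-plane Re z > 0. *)
Definition cGamma (R : realType) (z : R[i]) : R[i] :=
  cintegral (@lebesgue_measure R) `]0, +oo[
    (fun x : R => cpow x (z - 1) * (expR (- x))%:C).

Definition charfun d (T : measurableType d) (R : realType)
    (P : probability T R) (X : T -> R) (t : R) : R[i] :=
  cintegral P setT (fun w => cexp (0 +i* (t * X w))).

Definition is_charfun (R : realType) (phi : R -> R[i]) : Prop :=
  exists (d : measure_display) (T : measurableType d) (P : probability T R)
         (X : {RV P >-> R}), forall t : R, charfun P X t = phi t.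

(* Used for 0 < alpha < 1. *)
Definition positive_stable d (T : measurableType d) (R : realType)
    (P : probability T R) (alpha : R) (S : {RV P >-> R}) : Prop :=
  {ae P, forall w, 0 < S w} /\
  forall u : R, 0 <= u ->
    ('E_P[(fun w => expR (- (u * S w)))%R])%E = (expR (- (u `^ alpha)))%:E.

(* W, possibly on another probability space than Y, is a Y-size-biased version
   of Y. The ratio is meaningful when Y >= 0 and 0 < E Y < oo. *)
Definition size_biased d (T : measurableType d) d' (T' : measurableType d')
    (R : realType) (P : probability T R) (Y : T -> R)
    (P' : probability T' R) (W : {RV P' >-> R}) : Prop :=
  {ae P', forall w, 0 < W w} /\
  forall A : set R, measurable A -> A `<=` `[0, +oo[ ->
    (distribution P' W A = 'E_P[(fun w => Y w * \1_(Y @^-1` A) w)%R] / 'E_P[Y])%E.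

Definition Phi (R : realType) (p q t : R) : R[i] :=
  (cpow 2 ((0 +i* t) / p%:C) * cGamma ((1 +i* t) / p%:C)
     * cGamma (1 / q%:C)) /
  (cpow 2 ((0 +i* t) / q%:C) * cGamma ((1 +i* t) / q%:C)
     * cGamma (1 / p%:C)).

Definition Vpq (R : realType) (p q : R) (T : Type) (W : T -> R) (w : T) : R :=
  2 `^ (1 / p - 1 / q) * W w.

(* Main.v *)
(* A positive variable [S] with Laplace transform [exp (- u^alpha)] satisfies, by
   integrating [u^(s-1)] against both sides and using Tonelli,
   [Gamma s * E (S^-s) = Gamma (s / alpha) / alpha] for [Re s > 0].  With
   [alpha = p / q] and [s = (1 + i t) / q] this identifies the Mellin transform
   of the size-biased variable, hence the characteristic function of [log V],
   with [Phi p q].  All complex integrals are handled as real integrals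
   [gammaR a b th] of [x^(a-1) cos (b ln x + th) e^-x], the real part of
   [e^(i th) Gamma (a + i b)].

   Dividing by [Gamma] needs its non-vanishing.  If [X] has a gamma law of large
   parameter [a], then [ln (X / a)] is concentrated near 0, which gives
   [|Gamma (a + i b)|^2 >= Gamma a ^2 * (1 - 4 b^2 / (a - 1))]; the functional
   equation transports this to every [a > 0].  The same estimate turns the
   functional equation into the product
   [|Gamma (a + i b)|^2 / Gamma a ^2 = prod_k (1 + (b / (a + k))^2)^-1], whose
   factors are monotone along [b = a]; so [|Phi p q 1| > 1] when [q < p], which
   rules out a characteristic function.

   Existence of [S]: the sum of [N] independent copies of [v^(-1/alpha)], with [v]
   uniform on [0, N], has Laplace transform [(1 - Lam_N u / N)^N], which converges
   to [exp (- c u^alpha)].  Passing to the quantile functions of [exp (- sum)]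
   makes these monotone functions on [0, 1], and their pointwise limit along an
   ultrafilter has the limiting moments. *)
Require Import Defs.
From HB Require Import structures.
From mathcomp Require Import all_boot all_order all_algebra.
From mathcomp Require Import all_classical all_reals all_analysis.
From mathcomp Require Import measurable_realfun complex.
From mathcomp Require Import ring lra.

Set Implicit Arguments.
Unset Strict Implicit.
Unset Printing Implicit Defensive.
Import Order.TTheory GRing.Theory Num.Theory.
Import numFieldNormedType.Exports.

Local Open Scope classical_set_scope.
Local Open Scope ring_scope.
Local Open Scope complex_scope.

(** * Power substitution on the half-line *)

Lemma in_itv0y (R : realType) (x : R) : (x \in `]0, +oo[) = (0 < x).
Proof. by rewrite in_itv/= andbT. Qed.

(** These compact intervals are the images of [1/(n+2), n+2] under x -> l x^c, so the exhaustions on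
    the two sides of the substitution correspond. Starting at n+2 keeps every interval
    nondegenerate. *)
Lemma itv0y_bigcup (R : realType) (l c : R) : 0 < l -> 0 < c ->
  `]0, +oo[%classic = \bigcup_n (`[l * n.+2%:R^-1 `^ c, l * n.+2%:R `^ c]%classic : set R).
Proof.
move=> l0 c0; apply/seteqP; split=> x/=; last first.
  move=> [n _]/=; rewrite !in_itv/= andbT => /andP[+ _].
  by apply: lt_le_trans; rewrite mulr_gt0// powR_gt0.
rewrite in_itv/= andbT => x0.
pose y := (x / l) `^ c^-1.
have y0 : 0 < y by rewrite powR_gt0// divr_gt0.
have yE : x = l * y `^ c.
  by rewrite /y -powRrM mulVf ?gt_eqF// powRr1 ?divr_ge0 ?ltW// mulrCA mulfV ?mulr1// gt_eqF.
(* This index exceeds y + 1/y, hence both y and 1/y, which puts y in [1/(n+2), n+2]. *)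
exists (Num.bound (y + y^-1)) => //=.
have B : y + y^-1 < (Num.bound (y + y^-1)).+2%:R.
  apply: lt_le_trans (archi_boundP _) _; first by rewrite addr_ge0// ?invr_ge0 ltW.
  by rewrite ler_nat -addn2 leq_addr.
have vy0 : 0 < y^-1 by rewrite invr_gt0.
rewrite in_itv/= yE !ler_pM2l// !ge0_ler_powR ?nnegrE ?(ltW c0) ?(ltW y0)//=.
  by rewrite ltW// (le_lt_trans _ B)// lerDl ltW.
rewrite -[leRHS]invrK lef_pV2 ?posrE//.
by rewrite ltW// (le_lt_trans _ B)// lerDr ltW.
Qed.

Lemma itv0y_nondecreasing (R : realType) (l c : R) : 0 < l -> 0 < c ->
  nondecreasing_seq (fun n : nat =>
    (`[l * n.+2%:R^-1 `^ c, l * n.+2%:R `^ c]%classic : set R)).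
Proof.
move=> l0 c0 m n mn; apply/subsetPset; apply: subset_itv; rewrite leBSide/= ler_pM2l//.
  by rewrite ge0_ler_powR ?nnegrE ?(ltW c0)// lef_pV2 ?posrE// ler_nat ltnS.
by rewrite ge0_ler_powR ?nnegrE ?(ltW c0)// ler_nat ltnS.
Qed.

Lemma is_derive_mulpowR (R : realType) (l c x : R) : 0 < x ->
  is_derive x 1 (fun u => l * u `^ c) (l * (c * x `^ (c - 1))).
Proof.
move=> x0; have D := is_derive1_powR c x0.
exact: is_derive_eq.
Qed.

Lemma continuous_powR0y (R : realType) (c x : R) : 0 < x ->
  {for x, continuous (fun u => u `^ c)}.
Proof.
move=> x0; apply: differentiable_continuous; apply/derivable1_diffP.
by have [] := is_derive1_powR c x0.
Qed.

Lemma measurable_fun_itv0y (R : realType) (f : R -> R) :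
  (forall x : R, 0 < x -> {for x, continuous f}) -> measurable_fun `](0 : R), +oo[ f.
Proof.
move=> cf; apply: open_continuous_measurable_fun; first exact: interval_open.
by move=> x; rewrite inE/= in_itv0y => /cf.
Qed.

Section substitution.
Context (R : realType) (l c : R) (G : R -> R).
Hypotheses (l0 : 0 < l) (c0 : 0 < c)
  (cG : forall x : R, 0 < x -> {for x, continuous G}).
Local Notation mu := (@lebesgue_measure R).

Lemma continuous_mulpowR_deriv (x : R) : 0 < x ->
  {for x, continuous (fun u => G (l * u `^ c) * (l * (c * u `^ (c - 1))))}.
Proof.
move=> x0; apply: continuousM; last first.
  apply: continuousM; first exact: cst_continuous.
  apply: continuousM; first exact: cst_continuous.
  exact: continuous_powR0y.
apply: (@continuous_comp _ _ _ (fun u => l * u `^ c)).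
  apply: continuousM; first exact: cst_continuous.
  exact: continuous_powR0y.
by apply: cG; rewrite mulr_gt0// powR_gt0.
Qed.

Lemma powR_substitution_itv (a b : R) : 0 < a -> a < b ->
  (\int[mu]_(x in `[(l * a `^ c)%R, (l * b `^ c)%R]) (G x)%:E =
   \int[mu]_(x in `[a, b]) (G (l * x `^ c) * (l * (c * x `^ (c - 1))))%:E)%E.
Proof.
move=> a0 ab; pose F (x : R) := l * x `^ c.
have b0 : 0 < b by apply: lt_trans ab.
have dF x : 0 < x -> derive1 F x = l * (c * x `^ (c - 1)).
  move=> x0; have D := is_derive_mulpowR l c x0.
  by rewrite derive1E; exact: derive_val.
have cF x : 0 < x -> {for x, continuous F}.
  move=> x0; apply: differentiable_continuous; apply/derivable1_diffP.
  by have [] := is_derive_mulpowR l c x0.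
have cF' x : 0 < x -> {for x, continuous (derive1 F)}.
  move=> x0; rewrite /prop_for /continuous_at dF//.
  have : {for x, continuous (fun u => l * (c * u `^ (c - 1)))}.
    apply: continuousM; first exact: cst_continuous.
    apply: continuousM; first exact: cst_continuous.
    exact: continuous_powR0y.
  apply: cvg_trans; apply: near_eq_cvg; near=> y; rewrite dF//.
  by near: y; exact: lt_nbhsr.
rewrite -/(F a) -/(F b) (@integration_by_substitution_increasing _ F)//.
- apply: eq_integral => x; rewrite inE/= in_itv/= => /andP[ax _].
  by rewrite /= !fctE dF// (lt_le_trans a0).
- exact: ltW.
- move=> x y; rewrite !in_itv/= => /andP[ax _] /andP[ay _] xy.
  by rewrite ltr_pM2l// gt0_ltr_powR// nnegrE ltW// (lt_le_trans a0).
- by move=> x; rewrite in_itv/= => /andP[ax _]; apply: cF'; exact: lt_trans ax.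
- apply/cvg_ex; exists (derive1 F a); apply: cvg_at_right_filter; exact: cF'.
- apply/cvg_ex; exists (derive1 F b); apply: cvg_at_left_filter; exact: cF'.
- split.
  + move=> x; rewrite in_itv/= => /andP[ax _].
    by have [] := is_derive_mulpowR l c (lt_trans a0 ax).
  + by apply: cvg_at_right_filter; exact: cF.
  + by apply: cvg_at_left_filter; exact: cF.
- apply: continuous_in_subspaceT => x; rewrite inE/= in_itv/= => /andP[Fx _].
  by apply: cG; apply: lt_le_trans Fx; rewrite mulr_gt0// powR_gt0.
Unshelve. all: by end_near. Qed.

End substitution.

(** Monotone convergence along the corresponding compact exhaustions passes from intervals to the
    half-line; this is where [G] has to be nonnegative. Staying away from 0 leaves [G] free to be
    singular there. *)
Lemma powR_substitution_ge0 (R : realType) (l c : R) (G : R -> R) :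
    0 < l -> 0 < c -> (forall x : R, 0 < x -> {for x, continuous G}) ->
    (forall x : R, 0 < x -> 0 <= G x) ->
  (\int[@lebesgue_measure R]_(x in `]0%R, +oo[) (G x)%:E =
   \int[@lebesgue_measure R]_(x in `]0%R, +oo[)
     (G (l * x `^ c) * (l * (c * x `^ (c - 1))))%:E)%E.
Proof.
move=> l0 c0 cG G0.
have mG := measurable_fun_itv0y cG.
have mG' := measurable_fun_itv0y (continuous_mulpowR_deriv (c := c) l0 cG).
have cvgL : (\int[@lebesgue_measure R]_(x in
      `[(l * n.+2%:R^-1 `^ c)%R, (l * n.+2%:R `^ c)%R]) (G x)%:E)%E @[n --> \oo]
    --> (\int[@lebesgue_measure R]_(x in `]0%R, +oo[) (G x)%:E)%E.
  rewrite (itv0y_bigcup l0 c0).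
  apply: (@ge0_nondecreasing_set_cvg_integral _ (measurableTypeR R) R).
  - exact: itv0y_nondecreasing.
  - by move=> n; exact: measurable_itv.
  - move=> n; apply/measurable_EFinP; apply: measurable_funS mG => //.
    by rewrite (itv0y_bigcup l0 c0); by move=> x xn; exists n.
  - move=> n x; rewrite /= in_itv/= => /andP[+ _] => h; rewrite lee_fin G0//.
    by apply: lt_le_trans h; rewrite mulr_gt0// powR_gt0.
(* With l = c = 1 the exhaustion is [1/(n+2), n+2], whose image is the one used for [cvgL]. *)
have cvgR : (\int[@lebesgue_measure R]_(x in
      `[(1 * n.+2%:R^-1 `^ 1)%R, (1 * n.+2%:R `^ 1)%R])
      (G (l * x `^ c) * (l * (c * x `^ (c - 1))))%:E)%E @[n --> \oo]
    --> (\int[@lebesgue_measure R]_(x in `]0%R, +oo[)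
      (G (l * x `^ c) * (l * (c * x `^ (c - 1))))%:E)%E.
  rewrite (itv0y_bigcup ltr01 ltr01).
  apply: (@ge0_nondecreasing_set_cvg_integral _ (measurableTypeR R) R).
  - exact: itv0y_nondecreasing.
  - by move=> n; exact: measurable_itv.
  - move=> n; apply/measurable_EFinP; apply: measurable_funS mG' => //.
    by rewrite (itv0y_bigcup ltr01 ltr01); by move=> x xn; exists n.
  - move=> n x; rewrite /= in_itv/= => /andP[+ _] => h.
    have x0 : 0 < x by apply: lt_le_trans h; rewrite mulr_gt0// powR_gt0.
    by rewrite lee_fin mulr_ge0 ?G0 ?mulr_ge0 ?powR_ge0 ?(ltW l0) ?(ltW c0) ?mulr_gt0 ?powR_gt0.
move/cvg_lim : cvgL => <- //; move/cvg_lim : cvgR => <- //.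
congr (lim (_ @ \oo)); apply/funext => n.
rewrite !mul1r !powRr1 ?invr_ge0// powR_substitution_itv//.
by rewrite (@lt_trans _ _ 1)// ?invf_lt1// ltr1n.
Qed.

(** * Gamma integrals *)

Lemma integral_expRN_0y (R : realType) :
  (\int[@lebesgue_measure R]_(x in `]0%R, +oo[) (expR (- x))%:E = 1)%E.
Proof.
rewrite integral_itv_obnd_cbnd//; last first.
  apply/measurable_EFinP; apply: measurable_funTS.
  by apply: measurableT_comp => //; exact: measurable_oppr.
rewrite (@ge0_continuous_FTC2y _ _ (fun x => - expR (- x)) _ 0).
- by rewrite oppr0 expR0 -EFinB sub0r opprK.
- by move=> x _; exact: expR_ge0.
- apply: continuous_subspaceT => x.
  by apply: continuous_comp; [exact: opp_continuous|exact: continuous_expR].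
- by rewrite -[X in _ --> X]oppr0; apply: cvgN; exact: cvgr_expR.
- by move=> x _; exact: ex_derive.
- apply: cvg_at_right_filter; apply: cvgN.
  by apply: continuous_comp; [exact: opp_continuous|exact: continuous_expR].
- move=> x _; rewrite derive1E; apply: derive_val.
  by apply: is_derive_eq; rewrite ?scaleNr ?scalerN ?scale1r ?mulrN1 opprK.
Qed.

(** Apply ln y < y at y = x / (2m): then m ln x = m ln (2m) + m ln y is at most m ln (2m) + x/2,
    which dictates the constant. *)
Lemma powR_le_expR (R : realType) (m : R) : 0 <= m ->
  exists2 C : R, 0 < C & forall x : R, 0 < x -> x `^ m <= C * expR (x / 2).
Proof.
move=> m0; exists (expR (m * ln (2 * m))) => [|x x0]; first exact: expR_gt0.
have [->|m_neq0] := eqVneq m 0.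
  by rewrite powRr0 mul0r expR0 mul1r -expR0 ler_expR divr_ge0// ltW.
have m_gt0 : 0 < m by rewrite lt_neqAle eq_sym m_neq0.
rewrite -expRD /powR gt_eqF// ler_expR -lerBlDl -mulrBr -ln_div ?posrE ?mulr_gt0//.
rewrite (_ : x / 2 = m * (x / (2 * m))); last by field.
rewrite ler_pM2l// ltW// ln_sublinear// divr_gt0// mulr_gt0//.
Qed.

Lemma powR_le_add1 (R : realType) (c x : R) : 0 < x -> 0 <= c <= 1 -> x `^ c <= 1 + x.
Proof.
move=> x0 /andP[c0 c1]; have [x1|/ltW x1] := leP x 1.
  apply: (@le_trans _ _ 1); last by rewrite lerDl ltW.
  by rewrite -[leRHS](powRr0 x) ger_powR// x0.
apply: (@le_trans _ _ x); last by rewrite lerDr.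
by rewrite -[leRHS]powRr1 ?(ltW x0)// ler_powR.
Qed.

(** The majorant is the pullback of e^-y under y = l x^c, so substitution gives its integral. With c
    = min(a, 1) it is singular enough at 0, and the surplus x^(a-c) is absorbed by e^(x/2). With l =
    1/2, the bound x^c <= 1 + x costs a factor e^(1/2), and 2/c cancels l c. *)
Lemma gamma_dominated (R : realType) (a : R) : 0 < a -> exists l c C : R,
  [/\ 0 < l, 0 < c & forall x : R, 0 < x ->
     x `^ (a - 1) * expR (- x) <= C * (expR (- (l * x `^ c)) * (l * (c * x `^ (c - 1))))].
Proof.
move=> a0; pose c := Num.min a 1.
have c0 : 0 < c by rewrite lt_min a0 ltr01.
have c1 : 0 <= c <= 1 by rewrite (ltW c0) ge_min lexx orbT.
have ca : 0 <= a - c by rewrite subr_ge0 ge_min lexx.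
have [C C0 xC] := powR_le_expR ca.
exists 2^-1, c, (C * expR 2^-1 * 2 / c); split => // x x0.
rewrite (_ : a - 1 = (a - c) + (c - 1)); last by ring.
rewrite powRD; last by rewrite (gt_eqF x0) implybT.
have -> : C * expR 2^-1 * 2 / c * (expR (- (2^-1 * x `^ c)) * (2^-1 * (c * x `^ (c - 1)))) =
   C * (expR (2^-1 - 2^-1 * x `^ c)) * x `^ (c - 1).
  by rewrite expRD; field; rewrite gt_eqF.
rewrite mulrAC ler_wpM2r ?powR_ge0//.
apply: le_trans (ler_wpM2r (expR_ge0 _) (xC _ x0)) _.
rewrite -mulrA ler_pM2l// -expRD ler_expR.
by have := powR_le_add1 x0 c1; lra.
Qed.

Definition gamma_fun (R : realType) (a b th x : R) : R :=
  x `^ (a - 1) * cos (b * ln x + th) * expR (- x).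

(** One real integral serves both parts of Gamma: phase 0 gives the real part and phase [- (pi / 2)]
    the imaginary part. *)
Definition gammaR (R : realType) (a b th : R) : R :=
  \int[@lebesgue_measure R]_(x in `]0%R, +oo[) gamma_fun a b th x.

Lemma continuous_gamma_phase (R : realType) (b th x : R) : 0 < x ->
  {for x, continuous (fun y => cos (b * ln y + th))}.
Proof.
move=> x0; apply: continuous_comp; last exact: continuous_cos.
apply: continuousD; last exact: cst_continuous.
by apply: continuousM; [exact: cst_continuous|exact: continuous_ln].
Qed.

Lemma continuous_gamma_fun (R : realType) (a b th x : R) : 0 < x ->
  {for x, continuous (gamma_fun a b th)}.
Proof.
move=> x0; apply: continuousM.
  apply: continuousM; first exact: continuous_powR0y.
  exact: continuous_gamma_phase.
by apply: continuous_comp; [exact: opp_continuous|exact: continuous_expR].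
Qed.

Lemma integrable_gamma_fun (R : realType) (a b th : R) : 0 < a ->
  (@lebesgue_measure R).-integrable `]0%R, +oo[ (EFin \o gamma_fun a b th).
Proof.
move=> a0; have [l [c [C [l0 c0 domC]]]] := gamma_dominated a0.
pose g x := expR (- (l * x `^ c)) * (l * (c * x `^ (c - 1))).
have ce (x : R) : 0 < x -> {for x, continuous (fun y : R => expR (- y))}.
  by move=> _; apply: continuous_comp; [exact: opp_continuous|exact: continuous_expR].
have mg : measurable_fun `](0 : R), +oo[ g.
  exact: measurable_fun_itv0y (continuous_mulpowR_deriv (c := c) l0 ce).
have g0 x : 0 <= g x.
  by rewrite mulr_ge0 ?expR_ge0// mulr_ge0 ?(ltW l0)// mulr_ge0 ?(ltW c0) ?powR_ge0.
have ig : (@lebesgue_measure R).-integrable `]0%R, +oo[ (EFin \o g).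
  apply/integrableP; split; first exact/measurable_EFinP.
  under eq_integral do rewrite /= ger0_norm//.
  rewrite -(@powR_substitution_ge0 R l c (fun y => expR (- y)))//.
  by rewrite integral_expRN_0y ltry.
apply: (le_integrable _ _ _ (integrableZl _ C ig)) => //.
- by apply/measurable_EFinP; apply: measurable_fun_itv0y; exact: continuous_gamma_fun.
- move=> x /=; rewrite in_itv/= andbT => x0; rewrite lee_fin.
  rewrite (le_trans _ (ler_norm _))// (le_trans _ (domC x x0))//.
  rewrite !normrM (ger0_norm (powR_ge0 _ _)) (ger0_norm (expR_ge0 _)).
  by rewrite ler_wpM2r ?expR_ge0// ler_piMr ?powR_ge0// cos_max.
Qed.

Lemma powR_expR (R : realType) (x p : R) : 0 < x -> x `^ p = expR (p * ln x).
Proof. by move=> x0; rewrite /powR gt_eqF. Qed.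

Lemma EFin_gammaR (R : realType) (a b th : R) : 0 < a ->
  (\int[@lebesgue_measure R]_(x in `]0%R, +oo[) (gamma_fun a b th x)%:E =
   (gammaR a b th)%:E)%E.
Proof.
move=> a0; rewrite /gammaR /Rintegral fineK//.
exact: integrable_fin_num (integrable_gamma_fun _ _ a0).
Qed.

Lemma gammaR_phase (R : realType) (a b th : R) : 0 < a ->
  gammaR a b th = cos th * gammaR a b 0 - sin th * gammaR a b (- (pi / 2)).
Proof.
move=> a0.
have i0 := integrable_gamma_fun b 0 a0.
have i1 := integrable_gamma_fun b (- (pi / 2)) a0.
rewrite /gammaR -!RintegralZl// -RintegralB//; last 2 first.
- exact: (integrableZl _ (cos th) i0).
- exact: (integrableZl _ (sin th) i1).
apply: eq_Rintegral => x _; rewrite /gamma_fun cosBpihalf addr0 cosD; ring.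
Qed.

Lemma cGammaE (R : realType) (a b : R) :
  cGamma (a +i* b) = gammaR a b 0 +i* gammaR a b (- (pi / 2)).
Proof.
rewrite /cGamma /cintegral; congr (_ +i* _); apply: eq_Rintegral => x;
  rewrite inE/= in_itv/= andbT => x0; rewrite /gamma_fun /cpow /cexp/= powR_expR//.
- rewrite !(mul0r, mulr0, subr0, addr0, add0r, oppr0, sub0r). ring.
- rewrite cosBpihalf !(mul0r, mulr0, subr0, addr0, add0r, oppr0, sub0r). ring.
Qed.

Lemma gammaR_sin0 (R : realType) (a : R) : gammaR a 0 (- (pi / 2)) = 0.
Proof.
rewrite /gammaR /Rintegral integral0_eq// => x _.
by rewrite /gamma_fun mul0r add0r cosN cos_pihalf mulr0 mul0r.
Qed.

Lemma cGamma_real (R : realType) (a : R) : cGamma (a%:C) = (gammaR a 0 0)%:C.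
Proof. by rewrite cGammaE gammaR_sin0. Qed.

(** Substitute y = l x^c in the Gamma integral; the phase shift by - b ln l compensates the term ln
    l in ln y. The summand 1 keeps the integrand nonnegative. The moment computation uses this at c
    = 1 and at l = 1. *)
Lemma integral_gamma_powR (R : realType) (a b th l c : R) : 0 < a -> 0 < l -> 0 < c ->
  (\int[@lebesgue_measure R]_(x in `]0%R, +oo[)
     (x `^ (c * a - 1) * (1 + cos (c * b * ln x + th)) * expR (- (l * x `^ c)))%:E =
   (c^-1 * l `^ (- a) * (gammaR a 0 0 + gammaR a b (th - b * ln l)))%:E)%E.
Proof.
move=> a0 l0 c0.
pose G x := gamma_fun a 0 0 x + gamma_fun a b (th - b * ln l) x.
have iG : (\int[@lebesgue_measure R]_(x in `]0%R, +oo[) (G x)%:E =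
    (gammaR a 0 0 + gammaR a b (th - b * ln l))%:E)%E.
  rewrite EFinD -!EFin_gammaR// -integralD_EFin//; exact: integrable_gamma_fun.
have G0 x : 0 < x -> 0 <= G x.
  move=> x0; rewrite /G /gamma_fun -mulrDl -mulrDr mul0r add0r cos0.
  by rewrite mulr_ge0 ?expR_ge0// mulr_ge0 ?powR_ge0//.
have cG x : 0 < x -> {for x, continuous G}.
  by move=> x0; apply: continuousD; exact: continuous_gamma_fun.
rewrite EFinM -iG (@powR_substitution_ge0 _ l c G)// -ge0_integralZl//; last 3 first.
- apply/measurable_EFinP; apply: measurable_fun_itv0y.
  exact: continuous_mulpowR_deriv.
- move=> x; rewrite /= in_itv/= andbT => x0; rewrite lee_fin mulr_ge0//.
    by apply: G0; rewrite mulr_gt0// powR_gt0.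
  by rewrite mulr_ge0 ?(ltW l0)// mulr_ge0 ?(ltW c0) ?powR_ge0.
- by rewrite lee_fin mulr_ge0 ?powR_ge0// invr_ge0 ltW.
apply: eq_integral => x; rewrite inE/= in_itv/= andbT => x0.
have xc0 : 0 < x `^ c by rewrite powR_gt0.
have lxc0 : 0 < l * x `^ c by rewrite mulr_gt0.
rewrite -EFinM; congr EFin.
rewrite /G /gamma_fun -mulrDl -mulrDr mul0r add0r cos0.
have -> : b * ln (l * x `^ c) + (th - b * ln l) = c * b * ln x + th.
  by rewrite lnM ?posrE// ln_powR; ring.
have E : x `^ (c * a - 1) =
    c^-1 * l `^ (- a) * ((l * x `^ c) `^ (a - 1) * (l * (c * x `^ (c - 1)))).
  rewrite (powR_expR _ lxc0) !powR_expR// lnM ?posrE// ?expR_gt0// expRK.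
  rewrite -[X in _ = _ * (_ * (X * _))](@lnK R) ?posrE//.
  rewrite [RHS](_ : _ = (c^-1 * c) * (expR (- a * ln l) * expR ((a - 1) * (ln l + c * ln x))
    * expR (ln l) * expR ((c - 1) * ln x))); last by ring.
  by rewrite mulVf ?gt_eqF// mul1r -!expRD; congr expR; ring.
rewrite E; ring.
Qed.

(** Since [f] may change sign, the passage from [1/(n+2), n+2] to the half-line is by dominated
    convergence with majorant |f|. Boundary limits along these endpoints are then enough. *)
Lemma Rintegral_FTC_itv0y (R : realType) (F f : R -> R) (l0 l1 : R) :
    (forall x : R, 0 < x -> is_derive x 1 F (f x)) ->
    (forall x : R, 0 < x -> {for x, continuous f}) ->
    (@lebesgue_measure R).-integrable `]0%R, +oo[ (EFin \o f) ->
    F n.+2%:R^-1 @[n --> \oo] --> l0 -> F n.+2%:R @[n --> \oo] --> l1 ->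
  \int[@lebesgue_measure R]_(x in `]0%R, +oo[) f x = l1 - l0.
Proof.
move=> dF cf intf Fl0 Fl1.
pose A n : set R := `[n.+2%:R^-1, n.+2%:R]%classic.
have A0 n : A n `<=` `]0, +oo[%classic.
  move=> x; rewrite /A/= !in_itv/= andbT => /andP[+ _].
  by apply: lt_le_trans; rewrite invr_gt0.
have mA n : measurable (A n) by exact: measurable_itv.
have intA n : (\int[@lebesgue_measure R]_(x in A n) (f x)%:E =
    (F n.+2%:R - F n.+2%:R^-1)%:E)%E.
  have cF (x : R) : 0 < x -> {for x, continuous F}.
    move=> x0; apply: differentiable_continuous; apply/derivable1_diffP.
    by have [] := dF x x0.
  have v0 : 0 < (n.+2%:R : R)^-1 by rewrite invr_gt0.
  rewrite EFinB; apply: continuous_FTC2.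
  - by rewrite (@lt_trans _ _ 1)// ?invf_lt1// ltr1n.
  - apply: continuous_in_subspaceT => x; rewrite inE/= => /(A0 n).
    by rewrite /= in_itv/= andbT => /cf.
  - split.
    + move=> x; rewrite in_itv/= => /andP[x0 _].
      by have [] := dF x (lt_trans v0 x0).
    + by apply: cvg_at_right_filter; exact: cF.
    + by apply: cvg_at_left_filter; exact: cF.
  - move=> x; rewrite in_itv/= => /andP[x0 _]; rewrite derive1E.
    have D := dF x (lt_trans v0 x0); exact: derive_val.
have mf : measurable_fun `](0 : R), +oo[ (EFin \o f).
  by have /integrableP[] := intf.
have [||||_ _] := @dominated_convergence _ _ R (@lebesgue_measure R) `]0%R, +oo[%classic
  (measurable_itv _) (fun n => (EFin \o f) \_ (A n)) (EFin \o f) (abse \o (EFin \o f)) _ mf.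
- move=> n; apply/(measurable_restrict (EFin \o f) (mA n)) => //.
  exact: measurable_funS mf.
- apply/aeW => x /=; rewrite in_itv/= andbT => x0; apply: cvg_near_cst.
  exists (Num.bound (x + x^-1)) => //= n /= nx.
  rewrite patchE mem_set// /A /=.
  have B : x + x^-1 < n.+2%:R.
    apply: lt_le_trans (archi_boundP _) _; first by rewrite addr_ge0// ?invr_ge0 ltW.
    by rewrite ler_nat (leq_trans nx)// -addn2 leq_addr.
  have vx0 : 0 < x^-1 by rewrite invr_gt0.
  rewrite in_itv/=; apply/andP; split.
    rewrite -[leRHS]invrK lef_pV2 ?posrE//.
    by rewrite ltW// (le_lt_trans _ B)// lerDr ltW.
  by rewrite ltW// (le_lt_trans _ B)// lerDl ltW.
- exact: integrable_abse.
- apply/aeW => x /= n _; rewrite patchE; case: ifP => // _.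
  by rewrite abse0.
rewrite /Rintegral => cv.
have -> : (\int[@lebesgue_measure R]_(x in `]0%R, +oo[) (f x)%:E = (l1 - l0)%:E)%E; last by [].
move/cvg_lim : cv => <- //; apply/cvg_lim => //.
rewrite (_ : (fun n => _) = fun n => (F n.+2%:R - F n.+2%:R^-1)%:E).
  by apply: cvg_EFin; [near=> n|apply: cvgB].
apply/funext => n /=; rewrite -intA -integral_mkcondr setIidr//; exact: A0.
Unshelve. all: by end_near. Qed.

Lemma is_derive_gamma_phase (R : realType) (b th x : R) : 0 < x ->
  is_derive x 1 (fun y => cos (b * ln y + th)) (- sin (b * ln x + th) * (b / x)).
Proof.
move=> x0; apply: (@is_derive1_comp _ cos (fun y => b * ln y + th)).
have D2 := is_derive1_ln x0.
by apply: is_derive_eq; rewrite addr0.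
Qed.

Lemma cvg_invSS (R : realType) : (n.+2%:R^-1 : R) @[n --> \oo] --> 0.
Proof. by rewrite (cvg_shiftS (@harmonic R)); exact: cvg_harmonic. Qed.

(** These are the boundary terms of the integration by parts for Gamma, [p] being the bounded
    oscillating factor. *)
Lemma cvg0_powR_expRN (R : realType) (a : R) (p : nat -> R) : 0 < a ->
  (forall n, `|p n| <= 1) ->
  (n.+2%:R^-1 `^ a * p n * expR (- n.+2%:R^-1) @[n --> \oo] --> 0) /\
  (n.+2%:R `^ a * p n * expR (- n.+2%:R) @[n --> \oo] --> 0).
Proof.
move=> a0 p1; split; apply/norm_cvg0P.
- have H : (n.+2%:R^-1 : R) `^ a @[n --> \oo] --> 0.
    apply: ((cvg_at_rightP _ _ _).1 (powR_cvg0 a0)); split; last exact: cvg_invSS.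
    by move=> n; rewrite invr_gt0.
  apply: squeeze_cvgr (cvg_cst 0) H; apply: nearW => n.
  rewrite normr_ge0/= !normrM ger0_norm ?powR_ge0// -mulrA ler_piMr ?powR_ge0//.
  rewrite mulr_ile1 ?p1// ger0_norm ?expR_ge0// -expR0 ler_expR oppr_le0 invr_ge0//.
(* From x^a <= C e^(x/2) the term is at most C e^(-x/2), and e^(x/2) >= x/2 bounds this by 2C/x. *)
- have [C C0 xC] := powR_le_expR (ltW a0).
  have H : C * 2 * n.+2%:R^-1 @[n --> \oo] --> 0.
    by rewrite -[X in _ --> X](mulr0 (C * 2)); apply: cvgMr; exact: cvg_invSS.
  apply: squeeze_cvgr (cvg_cst 0) H; apply: nearW => n.
  rewrite normr_ge0/= !normrM ger0_norm ?powR_ge0// (ger0_norm (expR_ge0 _)).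
  apply: (@le_trans _ _ (n.+2%:R `^ a * expR (- n.+2%:R))).
    by rewrite ler_wpM2r ?expR_ge0// ler_piMr ?powR_ge0.
  apply: le_trans (ler_wpM2r (expR_ge0 _) (xC _ (ltr0Sn _ _))) _.
  rewrite -!mulrA ler_pM2l// -expRD.
  rewrite (_ : n.+2%:R / 2 - n.+2%:R = - (n.+2%:R / 2)); last by field.
  rewrite -[leRHS]invrK invfM invrK expRN lef_pV2 ?posrE ?expR_gt0 ?divr_gt0//.
  by apply: le_trans (expR_ge1Dx _); rewrite mulrC lerDr.
Qed.

(** Integration by parts gives the real form of Gamma(z+1) = z Gamma(z) at z = a + ib. The factor i
    in ib rotates the phase by pi/2, which appears as minus the phase [th - pi / 2]. *)
Lemma gammaR_D1 (R : realType) (a b th : R) : 0 < a ->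
  gammaR (a + 1) b th = a * gammaR a b th - b * gammaR a b (th - pi / 2).
Proof.
move=> a0.
pose F x := x `^ a * cos (b * ln x + th) * expR (- x).
(* This is the derivative of [F]. Since [F] tends to 0 at both ends, its integral vanishes. *)
pose f x := a * gamma_fun a b th x - b * gamma_fun a b (th - pi / 2) x
  - gamma_fun (a + 1) b th x.
have dF (x : R) : 0 < x -> is_derive x 1 F (f x).
  move=> x0.
  have D1 := is_derive1_powR a x0.
  have D2 := is_derive1_ln x0.
  have D3 : is_derive x 1 (fun y => cos (b * ln y + th)) (- sin (b * ln x + th) * (b / x)).
    exact: is_derive_gamma_phase.
  apply: is_derive_eq.
  rewrite /f /gamma_fun addrK addrA cosBpihalf.
  have -> : x `^ a = x `^ (a - 1) * x.
    by rewrite mulrC mulr_powRB1// ltW.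
  by rewrite /GRing.scale /=; field; rewrite gt_eqF.
have cf (x : R) : 0 < x -> {for x, continuous f}.
  move=> x0; apply: continuousB; last exact: continuous_gamma_fun.
  apply: continuousB; (apply: continuousM; first exact: cst_continuous);
    exact: continuous_gamma_fun.
have i0 := integrable_gamma_fun b th a0.
have i1 := integrable_gamma_fun b (th - pi / 2) a0.
have i2 := integrable_gamma_fun b th (addr_gt0 a0 ltr01).
have j0 : (@lebesgue_measure R).-integrable `]0%R, +oo[ (fun x => (a * gamma_fun a b th x)%:E).
  exact: (integrableZl _ a i0).
have j1 : (@lebesgue_measure R).-integrable `]0%R, +oo[
    (fun x => (b * gamma_fun a b (th - pi / 2) x)%:E).
  exact: (integrableZl _ b i1).
have i3 : (@lebesgue_measure R).-integrable `]0%R, +oo[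
    (fun x => (a * gamma_fun a b th x - b * gamma_fun a b (th - pi / 2) x)%:E).
  exact: (integrableB _ j0 j1).
have i4 : (@lebesgue_measure R).-integrable `]0%R, +oo[ (EFin \o f).
  exact: (integrableB _ i3 i2).
have := @Rintegral_FTC_itv0y R F f 0 0 dF cf i4.
rewrite subrr => H; apply/eqP; rewrite eq_sym -subr_eq0; apply/eqP.
rewrite -{}H.
- by rewrite /f RintegralB// ?RintegralB// ?RintegralZl.
- have [] := @cvg0_powR_expRN R a (fun n => cos (b * ln n.+2%:R^-1 + th)) a0 => //.
  by move=> n; exact: cos_max.
- have [] := @cvg0_powR_expRN R a (fun n => cos (b * ln n.+2%:R + th)) a0 => //.
  by move=> n; exact: cos_max.
Qed.

(** * Modulus of the gamma function on vertical lines *)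

(* [u cos phi + v sin phi <= sqrt (u^2 + v^2)] is integrated against [g], with
   [u] and [v] the two integrals themselves. *)
Lemma sqr_phase_integral_le d (T : measurableType d) (R : realType)
    (mu : {measure set T -> \bar R}) (D : set T) (g phi : T -> R) :
    measurable D -> (forall x, D x -> 0 <= g x) ->
    mu.-integrable D (EFin \o g) -> measurable_fun D phi ->
  (\int[mu]_(x in D) (g x * cos (phi x))) ^+ 2 +
  (\int[mu]_(x in D) (g x * sin (phi x))) ^+ 2 <= (\int[mu]_(x in D) g x) ^+ 2.
Proof.
move=> mD g0 ig mphi.
have mg : measurable_fun D g.
  by apply/measurable_EFinP; have /integrableP[] := ig.
have i0 : mu.-integrable D (fun x => (g x * cos (phi x))%:E).
  apply: (le_integrable _ _ _ ig) => //.
    apply/measurable_EFinP; apply: measurable_funM => //.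
    exact: (measurableT_comp (continuous_measurable_fun (@continuous_cos R))).
  move=> x Dx; rewrite lee_fin normrM ler_piMr//; exact: cos_max.
have i1 : mu.-integrable D (fun x => (g x * sin (phi x))%:E).
  apply: (le_integrable _ _ _ ig) => //.
    apply/measurable_EFinP; apply: measurable_funM => //.
    exact: (measurableT_comp (continuous_measurable_fun (@continuous_sin R))).
  move=> x Dx; rewrite lee_fin normrM ler_piMr//; exact: sin_max.
set u := Rintegral _ _ _; set v := Rintegral _ _ _; set G := Rintegral _ _ g.
pose r := Num.sqrt (u ^+ 2 + v ^+ 2).
have sq0 : 0 <= u ^+ 2 + v ^+ 2 by rewrite addr_ge0 ?sqr_ge0.
have r2 : r ^+ 2 = u ^+ 2 + v ^+ 2 by rewrite sqr_sqrtr.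
have r0 : 0 <= r by exact: sqrtr_ge0.
have j0 : mu.-integrable D (fun x => (u * (g x * cos (phi x)))%:E).
  exact: (integrableZl _ u i0).
have j1 : mu.-integrable D (fun x => (v * (g x * sin (phi x)))%:E).
  exact: (integrableZl _ v i1).
have j2 : mu.-integrable D (fun x => (r * g x)%:E).
  exact: (integrableZl _ r ig).
have j3 : mu.-integrable D (fun x => (u * (g x * cos (phi x)) + v * (g x * sin (phi x)))%:E).
  exact: (integrableD _ j0 j1).
have G0 : 0 <= G by apply: Rintegral_ge0.
have H : r ^+ 2 <= r * G.
  rewrite r2 2!expr2 {2}/u {2}/v /G -!RintegralZl// -RintegralD//.
  apply: le_Rintegral => // x Dx.
  set C := cos _; set S := sin _.
  have CS : C ^+ 2 + S ^+ 2 = 1 by exact: cos2Dsin2.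
  have -> : u * (g x * C) + v * (g x * S) = (u * C + v * S) * g x by ring.
  apply: ler_wpM2r; first exact: g0.
  rewrite (le_trans (ler_norm _))// -ler_sqr ?nnegrE ?normr_ge0// real_normK ?num_real// r2.
  rewrite -subr_ge0.
  have -> : u ^+ 2 + v ^+ 2 - (u * C + v * S) ^+ 2 = (u * S - v * C) ^+ 2.
    have -> : u ^+ 2 + v ^+ 2 = (u ^+ 2 + v ^+ 2) * (C ^+ 2 + S ^+ 2) by rewrite CS mulr1.
    ring.
  exact: sqr_ge0.
have [rz|rnz] := eqVneq r 0; first by rewrite -r2 rz expr0n/= sqr_ge0.
rewrite -r2 ler_sqr ?nnegrE//.
have rp : 0 < r by rewrite lt_neqAle eq_sym rnz.
by move: H; rewrite expr2 ler_pM2l.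
Qed.

Lemma sin_norm_le (R : realType) (x : R) : `|sin x| <= `|x|.
Proof.
wlog x0 : x / 0 < x => [H|].
  have [x0|x0|->] := ltgtP x 0; last by rewrite sin0 normr0.
    by rewrite -normrN -sinN -[leRHS]normrN H// oppr_gt0.
  exact: H.
have [|c _] := @MVT R sin cos 0 x x0 (fun y _ => is_derive_sin y).
  by apply: continuous_subspaceT; exact: continuous_sin.
rewrite sin0 !subr0 => ->.
by rewrite normrM ler_piMl ?normr_ge0// cos_max.
Qed.

Lemma cos_ge_quadratic (R : realType) (x : R) : 1 - x ^+ 2 / 2 <= cos x.
Proof.
rewrite [X in cos X](_ : x = (x / 2) *+ 2); last by rewrite -mulr_natr divfK.
rewrite cos_mulr2n cos2sin2.
have := sin_norm_le (x / 2); rewrite -ler_sqr ?nnegrE ?normr_ge0// !real_normK ?num_real//.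
rewrite expr_div_n; lra.
Qed.

(** Both sides are invariant under r -> 1/r, so r >= 1 may be assumed. For s = sqrt r, 0 <= ln s <=
    s - 1 <= s - 1/s, and squaring gives the bound. Its right side has an explicit mean under a
    gamma law, since only moments of orders 1 and -1 occur. *)
Lemma sqr_ln_le (R : realType) (r : R) : 0 < r -> ln r ^+ 2 <= 4 * (r - 2 + r^-1).
Proof.
wlog r1 : r / 1 <= r => [H r0|r0].
  have [r1|/ltW r1] := leP 1 r; first exact: H.
  have := H r^-1; rewrite invr_ge1 ?unitfE ?gt_eqF// => /(_ r1).
  rewrite invr_gt0 => /(_ r0); rewrite lnV ?posrE// sqrrN invrK.
  by rewrite addrAC (addrC r^-1) addrAC.
pose s := Num.sqrt r.
have s1 : 1 <= s by rewrite -sqrtr1 ler_wsqrtr.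
have s0 : 0 < s by apply: lt_le_trans s1.
have rE : r = s ^+ 2 by rewrite sqr_sqrtr ?ltW.
have ls : ln s <= s - s^-1.
  apply: (@le_trans _ _ (s - 1)); last by rewrite lerD2l lerN2 invf_le1.
  by have := @le_ln1Dx R (s - 1); rewrite addrCA subrr addr0; apply; lra.
have ls0 : 0 <= ln s by exact: ln_ge0.
rewrite rE lnXn// -[ln s *+ 2]mulr_natr exprMn mulrC -natrX ler_pM2l//.
have -> : s ^+ 2 - 2 + (s ^+ 2)^-1 = (s - s^-1) ^+ 2.
  by field; rewrite gt_eqF.
by rewrite ler_sqr ?nnegrE// (le_trans ls0 ls).
Qed.

Lemma gammaR00_gt0 (R : realType) (a : R) : 0 < a -> 0 < gammaR a 0 0.
Proof.
move=> a0.
(* On [1, 2] the monotone power x^(a-1) is at least the smaller of its endpoint values, and e^-x >=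
   e^-2. *)
pose c : R := Num.min 1 (2 `^ (a - 1)) * expR (- 2).
have c0 : 0 < c by rewrite mulr_gt0 ?expR_gt0// lt_min ltr01/= powR_gt0.
apply: (@lt_le_trans _ _ c) => //.
rewrite -lee_fin -EFin_gammaR//.
have g0 x : 0 <= gamma_fun a 0 0 x.
  by rewrite /gamma_fun mul0r addr0 cos0 mulr1 mulr_ge0 ?powR_ge0 ?expR_ge0.
have mg : measurable_fun `](0 : R), +oo[ (EFin \o gamma_fun a 0 0).
  by have /integrableP[] := integrable_gamma_fun 0 0 a0.
have S : [set` `[1%R, 2%R]] `<=` [set` `](0 : R), +oo[].
  move=> x; rewrite /= !in_itv/= andbT => /andP[+ _]; exact: lt_le_trans.
apply: (@le_trans _ _
  (\int[@lebesgue_measure R]_(x in `[1%R, 2%R]) (gamma_fun a 0 0 x)%:E)%E); last first.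
  by apply: ge0_subset_integral => //= x _; rewrite lee_fin.
apply: (@le_trans _ _ (\int[@lebesgue_measure R]_(x in `[1%R, 2%R]) c%:E)%E).
  rewrite integral_cst//= lebesgue_measure_itv/= lte_fin ltr1n/= -EFinD -EFinM.
  rewrite lee_fin (_ : 2 - 1 = 1) ?mulr1//; ring.
apply: ge0_le_integral => //=.
- by move=> x _; rewrite lee_fin ltW.
- exact: measurable_funS mg.
move=> x; rewrite in_itv/= => /andP[x1 x2]; rewrite lee_fin /gamma_fun.
have x0 : 0 < x by apply: lt_le_trans x1.
rewrite mul0r addr0 cos0 mulr1 ler_pM ?expR_ge0//.
- have [a1|/ltW a1] := leP 1 a.
    rewrite ge_min; apply/orP; left.
    have E1 : 1 `^ (a - 1) = 1 :> R by rewrite powR1.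
    by rewrite -[leLHS]E1 ge0_ler_powR ?nnegrE// ?subr_ge0// ltW.
  rewrite ge_min; apply/orP; right.
  rewrite -(opprB 1 a) !powRN lef_pV2 ?posrE ?powR_gt0//.
  by rewrite ge0_ler_powR ?nnegrE// ?subr_ge0// ltW.
- by rewrite ler_expR lerN2.
Qed.

(** The squared modulus of Gamma(a + ib). *)
Definition gamma_sq (R : realType) (a b : R) : R :=
  gammaR a b 0 ^+ 2 + gammaR a b (- (pi / 2)) ^+ 2.

Lemma gammaR00_D1 (R : realType) (a : R) : 0 < a ->
  gammaR (a + 1) 0 0 = a * gammaR a 0 0.
Proof. by move=> a0; rewrite gammaR_D1// mul0r subr0. Qed.

Lemma gamma_sq_D1 (R : realType) (a b : R) : 0 < a ->
  gamma_sq (a + 1) b = (a ^+ 2 + b ^+ 2) * gamma_sq a b.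
Proof.
move=> a0; rewrite /gamma_sq !gammaR_D1// sub0r.
rewrite (gammaR_phase b (- (pi / 2) - pi / 2) a0).
(* Two quarter turns make the phase - pi, which returns minus the real part. *)
rewrite -opprD -splitr cosN sinN cospi sinpi; ring.
Qed.

Lemma gamma_sq_le (R : realType) (a b : R) : 0 < a ->
  gamma_sq a b <= gammaR a 0 0 ^+ 2.
Proof.
move=> a0.
have mphi : measurable_fun `](0 : R), +oo[ (fun x => b * ln x).
  by apply: measurable_funTS; apply: measurable_funM => //; exact: measurable_ln.
have g0 x : `]0%R, +oo[%classic x -> 0 <= gamma_fun a 0 0 x.
  by move=> _; rewrite /gamma_fun mul0r addr0 cos0 mulr1 mulr_ge0 ?powR_ge0 ?expR_ge0.
have := @sqr_phase_integral_le _ _ R (@lebesgue_measure R) _ (gamma_fun a 0 0)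
  (fun x => b * ln x) (measurable_itv `]0%R, +oo[) g0 (integrable_gamma_fun 0 0 a0) mphi.
congr (_ ^+ 2 + _ ^+ 2 <= _); apply: eq_Rintegral => x _;
  rewrite /gamma_fun mul0r !addr0 cos0; last rewrite cosBpihalf; ring.
Qed.

(** A rotation preserves the modulus; the difference of the two sides is the square of the rotated
    imaginary part. *)
Lemma gammaR_sqr_le (R : realType) (a b th : R) : 0 < a ->
  gammaR a b th ^+ 2 <= gamma_sq a b.
Proof.
move=> a0; rewrite gammaR_phase// /gamma_sq -subr_ge0.
set u := gammaR a b 0; set v := gammaR _ _ _; set C := cos _; set S := sin _.
have CS : C ^+ 2 + S ^+ 2 = 1 by exact: cos2Dsin2.
have -> : u ^+ 2 + v ^+ 2 - (C * u - S * v) ^+ 2 = (S * u + C * v) ^+ 2.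
  have -> : u ^+ 2 + v ^+ 2 = (u ^+ 2 + v ^+ 2) * (C ^+ 2 + S ^+ 2) by rewrite CS mulr1.
  ring.
exact: sqr_ge0.
Qed.

(** The phase - b ln a centres the logarithm: the integrand carries cos (b ln (x/a)), which is at
    least 1 - 2 b^2 (x/a - 2 + a/x). Under the gamma law of parameter a, x/a has mean 1 and a/x has
    mean a/(a-1), so the bracket has mean 1/(a-1). *)
Lemma gammaR_ge (R : realType) (a b : R) : 1 < a ->
  gammaR a 0 0 * (1 - 2 * b ^+ 2 / (a - 1)) <= gammaR a b (- (b * ln a)).
Proof.
move=> a1; have a0 : 0 < a by apply: lt_trans a1.
have am0 : 0 < a - 1 by rewrite subr_gt0.
have i0 := integrable_gamma_fun 0 0 a0.
have i1 := integrable_gamma_fun 0 0 (addr_gt0 a0 ltr01).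
have i2 := integrable_gamma_fun 0 0 am0.
have i3 := integrable_gamma_fun b (- (b * ln a)) a0.
pose k := 2 * b ^+ 2.
have j0 : (@lebesgue_measure R).-integrable `]0%R, +oo[
    (fun x => ((1 + 2 * k) * gamma_fun a 0 0 x)%:E).
  exact: (integrableZl _ (1 + 2 * k) i0).
have j1 : (@lebesgue_measure R).-integrable `]0%R, +oo[
    (fun x => (k / a * gamma_fun (a + 1) 0 0 x)%:E).
  exact: (integrableZl _ (k / a) i1).
have j2 : (@lebesgue_measure R).-integrable `]0%R, +oo[
    (fun x => (k * a * gamma_fun (a - 1) 0 0 x)%:E).
  exact: (integrableZl _ (k * a) i2).
have j3 : (@lebesgue_measure R).-integrable `]0%R, +oo[
    (fun x => ((1 + 2 * k) * gamma_fun a 0 0 x - k / a * gamma_fun (a + 1) 0 0 x)%:E).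
  exact: (integrableB _ j0 j1).
have j4 : (@lebesgue_measure R).-integrable `]0%R, +oo[
    (fun x => ((1 + 2 * k) * gamma_fun a 0 0 x - k / a * gamma_fun (a + 1) 0 0 x
      - k * a * gamma_fun (a - 1) 0 0 x)%:E).
  exact: (integrableB _ j3 j2).
have -> : gammaR a 0 0 * (1 - 2 * b ^+ 2 / (a - 1)) =
   (1 + 2 * k) * gammaR a 0 0 - k / a * gammaR (a + 1) 0 0 - k * a * gammaR (a - 1) 0 0.
  have E := gammaR00_D1 am0; rewrite subrK in E.
  rewrite gammaR00_D1// E /k; field.
  by rewrite !gt_eqF.
rewrite /gammaR -!RintegralZl// -!RintegralB//.
apply: le_Rintegral => //= x; rewrite in_itv/= andbT => x0.
rewrite /gamma_fun mul0r addr0 cos0 !mulr1.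
have -> : x `^ (a + 1 - 1) = x `^ (a - 1) * x.
  by rewrite addrK mulrC mulr_powRB1// ltW.
have -> : x `^ (a - 1) = x `^ (a - 1 - 1) * x.
  by rewrite mulrC mulr_powRB1// ltW.
set w := x `^ _.
have -> : (1 + 2 * k) * (w * x * expR (- x))
    - k / a * (w * x * x * expR (- x)) - k * a * (w * expR (- x))
  = (w * x * expR (- x)) * (1 - k * (x / a - 2 + (x / a)^-1)).
  by field; rewrite !gt_eqF.
have -> : cos (b * ln x - b * ln a) = cos (b * ln (x / a)).
  by rewrite ln_div ?posrE// mulrBr.
rewrite [leRHS](_ : _ = (w * x * expR (- x)) * cos (b * ln (x / a))); last by ring.
have w0 : 0 <= w * x * expR (- x).
  by rewrite mulr_ge0 ?expR_ge0// mulr_ge0 ?(ltW x0)// powR_ge0.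
apply: ler_wpM2l => //.
apply: le_trans (cos_ge_quadratic _); rewrite lerD2l lerN2 exprMn.
have xa0 : 0 < x / a by rewrite divr_gt0.
rewrite /k -mulrA; have := sqr_ln_le xa0; have := sqr_ge0 b; nra.
Qed.

(** Square the previous bound and use (1 - z)^2 >= 1 - 2z. The condition on [b] makes 1 - z
    nonnegative, so that squaring preserves the inequality. *)
Lemma gamma_sq_ge (R : realType) (a b : R) : 1 < a -> 2 * b ^+ 2 <= a - 1 ->
  gammaR a 0 0 ^+ 2 * (1 - 4 * b ^+ 2 / (a - 1)) <= gamma_sq a b.
Proof.
move=> a1 ba; have a0 : 0 < a by apply: lt_trans a1.
have am0 : 0 < a - 1 by rewrite subr_gt0.
apply: le_trans (gammaR_sqr_le b (- (b * ln a)) a0).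
apply: (@le_trans _ _ ((gammaR a 0 0 * (1 - 2 * b ^+ 2 / (a - 1))) ^+ 2)).
  rewrite exprMn ler_wpM2l ?sqr_ge0//.
  have := sqr_ge0 (2 * b ^+ 2 / (a - 1)).
  rewrite (_ : 4 * b ^+ 2 / (a - 1) = 2 * (2 * b ^+ 2 / (a - 1))); last by ring.
  set z := 2 * b ^+ 2 / (a - 1); nra.
rewrite ler_sqr ?nnegrE; first exact: gammaR_ge.
- by rewrite mulr_ge0 ?(ltW (gammaR00_gt0 a0))// subr_ge0 ler_pdivrMr// mul1r.
- apply: le_trans (gammaR_ge b a1).
  by rewrite mulr_ge0 ?(ltW (gammaR00_gt0 a0))// subr_ge0 ler_pdivrMr// mul1r.
Qed.

Definition gamma_ratio (R : realType) (a b : R) : R :=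
  gamma_sq a b / gammaR a 0 0 ^+ 2.

Lemma gamma_ratio_le1 (R : realType) (a b : R) : 0 < a -> gamma_ratio a b <= 1.
Proof.
move=> a0; rewrite ler_pdivrMr ?exprn_gt0 ?gammaR00_gt0// mul1r.
exact: gamma_sq_le.
Qed.

Lemma gamma_ratio_ge (R : realType) (a b : R) : 1 < a -> 2 * b ^+ 2 <= a - 1 ->
  1 - 4 * b ^+ 2 / (a - 1) <= gamma_ratio a b.
Proof.
move=> a1 ba; have a0 : 0 < a by apply: lt_trans a1.
by rewrite ler_pdivlMr ?exprn_gt0 ?gammaR00_gt0// mulrC gamma_sq_ge.
Qed.

Lemma gamma_ratio_D1 (R : realType) (a b : R) : 0 < a ->
  gamma_ratio (a + 1) b = (1 + (b / a) ^+ 2) * gamma_ratio a b.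
Proof.
move=> a0; rewrite /gamma_ratio gamma_sq_D1// gammaR00_D1//; field.
by rewrite !gt_eqF// gammaR00_gt0.
Qed.

Lemma gamma_ratio_Dn (R : realType) (a b : R) (n : nat) : 0 < a ->
  gamma_ratio (a + n%:R) b =
  (\prod_(k < n) (1 + (b / (a + k%:R)) ^+ 2)) * gamma_ratio a b.
Proof.
move=> a0; elim: n => [|n IH]; first by rewrite big_ord0 mul1r addr0.
have an0 : 0 < a + n%:R by rewrite ltr_wpDr.
rewrite -[n.+1%:R]natr1 addrA (gamma_ratio_D1 b an0) IH big_ord_recr/=.
by rewrite mulrA (mulrC (1 + _)).
Qed.

(** The recurrence would carry a zero at a to every a + n, against the lower bound for large n. *)
Lemma gamma_ratio_gt0 (R : realType) (a b : R) : 0 < a -> 0 < gamma_ratio a b.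
Proof.
move=> a0; have r0 : 0 <= gamma_ratio a b.
  by rewrite divr_ge0 ?sqr_ge0// addr_ge0 ?sqr_ge0.
rewrite lt_neqAle r0 andbT eq_sym; apply/eqP => r00.
have b0 := sqr_ge0 b.
(* The successor gives n - 1 > 4 b^2, so the lower bound at a + n is already positive. *)
pose n := (Num.bound (4 * b ^+ 2)).+1.
have nb : 4 * b ^+ 2 < n%:R - 1.
  rewrite (_ : n%:R = (Num.bound (4 * b ^+ 2))%:R + 1); last by rewrite natr1.
  by rewrite addrK archi_boundP// mulr_ge0.
have an1 : 0 < a + n%:R - 1 by lra.
have H : 1 - 4 * b ^+ 2 / (a + n%:R - 1) <= gamma_ratio (a + n%:R) b.
  by apply: gamma_ratio_ge; lra.
move: H; rewrite gamma_ratio_Dn// r00 mulr0 subr_le0 ler_pdivlMr// mul1r; lra.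
Qed.

(** Along b = a the factor 1 + (z/(z+k))^2 is nondecreasing in z, strictly so at k = 1. If the ratio
    at x were at most the one at y, then multiplying by n+2 factors would keep the ratio at x + n +
    2 below rho < 1. But that ratio tends to 1. Finite products suffice. *)
Lemma gamma_ratio_lt (R : realType) (x y : R) : 0 < x -> x < y ->
  gamma_ratio y y < gamma_ratio x x.
Proof.
move=> x0 xy; have y0 : 0 < y by apply: lt_trans xy.
pose h (z : R) (k : nat) := 1 + (z / (z + k%:R)) ^+ 2.
have h0 z k : 0 < h z k by rewrite /h ltr_wpDr ?sqr_ge0.
have h_le k : h x k <= h y k.
  rewrite /h lerD2l ler_sqr ?nnegrE ?divr_ge0 ?addr_ge0 ?(ltW x0) ?(ltW y0)//.
  rewrite ler_pdivrMr ?ltr_wpDr// mulrAC ler_pdivlMr ?ltr_wpDr//.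
  by rewrite !mulrDr mulrC lerD2l ler_wpM2r// ltW.
have h1_lt : h x 1 < h y 1.
  rewrite /h ltrD2l ltr_sqr ?nnegrE ?divr_ge0 ?addr_ge0 ?(ltW x0) ?(ltW y0)//.
  rewrite ltr_pdivrMr ?ltr_wpDr// mulrAC ltr_pdivlMr ?ltr_wpDr//.
  by rewrite !mulrDr mulrC ltrD2l !mulr1.
pose rho := h x 1 / h y 1.
have rho1 : rho < 1 by rewrite ltr_pdivrMr// mul1r.
have rho0 : 0 < rho by rewrite divr_gt0.
(* For k = 0 both factors equal 2; the gain rho comes from k = 1, so the induction starts with two
   factors. *)
have prod_le n : \prod_(k < n.+2) h x k <= rho * \prod_(k < n.+2) h y k.
  elim: n => [|n IH].
    rewrite !big_ord_recr !big_ord0/= !mul1r.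
    have -> : h x 0 = h y 0 by rewrite /h !addr0 !divff// gt_eqF.
    rewrite /rho [leRHS](_ : _ = h y 0 * h x 1)//; field.
    by rewrite gt_eqF.
  rewrite big_ord_recr [in leRHS]big_ord_recr/= mulrA ler_pM//.
    by apply: prodr_ge0 => k _; rewrite ltW.
  by rewrite ltW.
have gx := gamma_ratio_gt0 x x0.
rewrite ltNge; apply/negP => gle.
have tail n : gamma_ratio (x + n.+2%:R) x <= rho.
  rewrite gamma_ratio_Dn// -/(h x _).
  apply: (@le_trans _ _ ((rho * \prod_(k < n.+2) h y k) * gamma_ratio x x)).
    by apply: ler_wpM2r; [exact: ltW|exact: prod_le].
  rewrite -mulrA ler_piMr ?(ltW rho0)//.
  apply: le_trans (gamma_ratio_le1 y (_ : 0 < y + n.+2%:R)); last first.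
    by rewrite addr_gt0.
  rewrite gamma_ratio_Dn// ler_wpM2l//.
  by apply: prodr_ge0 => k _; rewrite ltW// h0.
have x20 := sqr_ge0 x.
have r10 : 0 < 1 - rho by rewrite subr_gt0.
(* For such n, 4 x^2 / (x + n + 1) < 1 - rho, which contradicts [tail]. *)
have [n nb] : exists n : nat, 4 * x ^+ 2 < n%:R * (1 - rho).
  exists (Num.bound (4 * x ^+ 2 / (1 - rho))); rewrite -ltr_pdivrMr//.
  by rewrite archi_boundP// divr_ge0 ?(ltW r10)// mulr_ge0.
have nb' : 4 * x ^+ 2 < n%:R.
  by apply: lt_le_trans nb _; rewrite ler_piMr// gerBl ltW.
have n0 : 0 <= n%:R :> R by [].
move: {tail}(tail n); rewrite (_ : n.+2%:R = n%:R + 2); last by rewrite -addn2 natrD.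
have d0 : 0 < x + (n%:R + 2) - 1 by clear - x0 n0; lra.
have a1 : 1 < x + (n%:R + 2) by rewrite -subr_gt0.
have a2 : 2 * x ^+ 2 <= x + (n%:R + 2) - 1 by clear - x0 x20 nb'; lra.
move=> /(le_trans (gamma_ratio_ge a1 a2)).
rewrite lerBlDl -lerBlDr ler_pdivlMr//.
by clear - x0 r10 nb; nra.
Qed.

(** * Moments of positive stable variables *)

Section stable_moments.
Context d (T : measurableType d) (R : realType) (P : probability T R)
  (alpha : R) (S : {RV P >-> R}).
Hypotheses (alpha0 : 0 < alpha) (stS : positive_stable alpha S).
Local Notation mu := (@lebesgue_measure R).

Lemma stable_laplace (u : R) : 0 <= u ->
  (\int[P]_w (expR (- (u * S w)))%:E = (expR (- (u `^ alpha)))%:E)%E.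
Proof. by move=> u0; rewrite -(stS.2 u u0) unlock. Qed.

(* [1 + cos] instead of [cos] makes the integrand nonnegative, as Tonelli needs;
   the case [b = th = 0] is subtracted afterwards. *)
Lemma stable_moment_phase (a b th : R) : 0 < a ->
  (\int[P]_w (S w `^ (- a) * (gammaR a 0 0 + gammaR a b (th - b * ln (S w))))%:E =
   (alpha^-1 * (gammaR (a / alpha) 0 0 + gammaR (a / alpha) (b / alpha) th))%:E)%E.
Proof.
move=> a0.
(* The indicator lets Tonelli run over the whole line. *)
pose k (u : R) := \1_(`]0%R, +oo[%classic) u * (u `^ (a - 1) * (1 + cos (b * ln u + th))).
have mk : measurable_fun [set: R] k.
  apply: measurable_funM; first exact: measurable_indic.
  apply: measurable_funM; first exact: measurable_powR.
  apply: measurable_funD => //; apply: measurableT_comp.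
    exact: (continuous_measurable_fun (@continuous_cos R)).
  by apply: measurable_funD => //; apply: measurable_funM => //; exact: measurable_ln.
have k0 u : 0 <= k u.
  rewrite mulr_ge0// mulr_ge0 ?powR_ge0//.
pose f (z : T * measurableTypeR R) := (k z.2 * expR (- (z.2 * S z.1)))%:E.
have mf : measurable_fun [set: T * measurableTypeR R] f.
  apply/measurable_EFinP; apply: measurable_funM.
    exact: (measurableT_comp mk measurable_snd).
  apply: measurableT_comp => //; apply: measurableT_comp => //.
  apply: measurable_funM; first exact: measurable_snd.
  by apply: measurableT_comp => //; exact: measurable_fst.
have f0 z : (0 <= f z)%E by rewrite lee_fin mulr_ge0 ?expR_ge0.
have := fubini_tonelli (m1 := P) (m2 := mu) f mf f0.
have inner (g : R -> R) : (\int[mu]_u (k u * g u)%:E =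
    \int[mu]_(u in `]0%R, +oo[) (u `^ (a - 1) * (1 + cos (b * ln u + th)) * g u)%:E)%E.
  rewrite [RHS]integral_mkcond; apply: eq_integral => u _.
  rewrite patchE /k indicE; case: ifPn => uI; first by rewrite mul1r.
  by rewrite !mul0r.
have -> : (\int[mu]_u \int[P]_w f (w, u) =
   (alpha^-1 * (gammaR (a / alpha) 0 0 + gammaR (a / alpha) (b / alpha) th))%:E)%E.
  transitivity (\int[mu]_u (k u * expR (- (u `^ alpha)))%:E)%E.
    apply: eq_integral => u _; rewrite /f/=.
    have [u0|u0] := leP u 0.
      have -> : k u = 0 by rewrite /k indicE memNset ?mul0r//= in_itv/= andbT ltNge u0.
      by under eq_integral do rewrite mul0r; rewrite integral0 mul0r.
    under eq_integral do rewrite EFinM.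
    rewrite ge0_integralZl//; last 2 first.
    - apply/measurable_EFinP; apply: measurableT_comp => //; apply: measurableT_comp => //.
      exact: measurable_funM.
    - by rewrite lee_fin.
    by rewrite stable_laplace ?ltW// EFinM.
  rewrite inner.
  (* After the Laplace transform is inserted, the integral in u is the case l = 1, c = alpha. *)
  have := @integral_gamma_powR R (a / alpha) (b / alpha) th 1 alpha
    (divr_gt0 a0 alpha0) ltr01 alpha0.
  rewrite powR1 mulr1 ln1 mulr0 subr0 => <-; apply: eq_integral => u _.
  by rewrite mul1r !(mulrC alpha) !divfK ?gt_eqF.
move=> <-; apply: ae_eq_integral => //.
- apply/measurable_EFinP; apply: measurable_funM.
    by apply: (measurableT_comp (measurable_powR _)).
  have mth : measurable_fun [set: T] (fun w => th - b * ln (S w)).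
    apply: measurable_funB => //; apply: measurable_funM => //.
    by apply: (measurableT_comp (@measurable_ln R)).
  apply: measurable_funD => //.
  under eq_fun do rewrite (gammaR_phase _ _ a0).
  apply: measurable_funB; apply: measurable_funM => //.
    exact: (measurableT_comp (continuous_measurable_fun (@continuous_cos R)) mth).
  exact: (measurableT_comp (continuous_measurable_fun (@continuous_sin R)) mth).
- exact: (@measurable_fun_fubini_tonelli_F _ _ _ _ _ mu f mf f0).
have [S0 _] := stS.
apply: filterS S0 => w Sw _ /=; rewrite inner.
(* In the other order, the integral at fixed w is the case l = S w, c = 1. It requires S w > 0,
   hence the almost everywhere comparison. *)
have := @integral_gamma_powR R a b th (S w) 1 a0 Sw ltr01.
rewrite invr1 !mul1r => <-; apply: eq_integral => u /[!inE]/=.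
rewrite in_itv/= andbT => u0.
by rewrite ?mul1r powRr1 ?(ltW u0)// (mulrC u).
Qed.

Lemma stable_moment (a : R) : 0 < a ->
  (\int[P]_w (S w `^ (- a))%:E =
   (alpha^-1 * (gammaR (a / alpha) 0 0 / gammaR a 0 0))%:E)%E.
Proof.
move=> a0; have G0 := gammaR00_gt0 a0.
have := stable_moment_phase 0 0 a0.
under eq_integral do rewrite mul0r subr0 -mulr2n EFinM.
rewrite ge0_integralZr//; last 3 first.
- by apply/measurable_EFinP; apply: (measurableT_comp (measurable_powR _)).
- by move=> w _; rewrite lee_fin powR_ge0.
- by rewrite lee_fin mulrn_wge0// ltW.
rewrite mul0r -mulr2n => H.
rewrite -[LHS]mule1 -(_ : (gammaR a 0 0 *+ 2)%:E * ((gammaR a 0 0 *+ 2)^-1)%:E = 1)%E; last first.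
  by rewrite -EFinM mulfV// gt_eqF// mulrn_wgt0.
rewrite muleA H -EFinM; congr EFin.
move: (gammaR a 0 0) (gammaR _ _ _) G0 => y z y0; field.
by rewrite !gt_eqF.
Qed.

Lemma integrable_stable_moment (a : R) : 0 < a ->
  P.-integrable setT (fun w => (S w `^ (- a))%:E).
Proof.
move=> a0; apply/integrableP; split.
  by apply/measurable_EFinP; apply: (measurableT_comp (measurable_powR _)).
under eq_integral do rewrite gee0_abs ?lee_fin ?powR_ge0//.
by rewrite stable_moment// ltry.
Qed.

Lemma measurable_stable_phase (b th : R) :
  measurable_fun setT (fun w => cos (th - b * ln (S w))).
Proof.
apply: measurableT_comp; first exact: (continuous_measurable_fun (@continuous_cos R)).
apply: measurable_funB => //; apply: measurable_funM => //.
by apply: (measurableT_comp (@measurable_ln R)).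
Qed.

Lemma integrable_stable_phase (a b th : R) : 0 < a ->
  P.-integrable setT (fun w => (S w `^ (- a) * cos (th - b * ln (S w)))%:E).
Proof.
move=> a0; apply: (le_integrable _ _ _ (integrable_stable_moment a0)) => //.
  apply/measurable_EFinP; apply: measurable_funM; last exact: measurable_stable_phase.
  by apply: (measurableT_comp (measurable_powR _)).
move=> w _; rewrite lee_fin normrM (ger0_norm (powR_ge0 _ _)).
by rewrite ler_piMr ?powR_ge0// cos_max.
Qed.

(** With s = a + ib, the left side is the real part of e^(i th) Gamma(s) E S^-s, obtained from the
    identity with 1 + cos by subtracting the moment of order a. *)
Lemma stable_moment_rotated (a b th : R) : 0 < a ->
  gammaR a b 0 * (\int[P]_w (S w `^ (- a) * cos (th - b * ln (S w))))
  - gammaR a b (- (pi / 2)) *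
     (\int[P]_w (S w `^ (- a) * cos (th - pi / 2 - b * ln (S w)))) =
  alpha^-1 * gammaR (a / alpha) (b / alpha) th.
Proof.
move=> a0.
have i0 := integrable_stable_moment a0.
have i1 := integrable_stable_phase b th a0.
have i2 := integrable_stable_phase b (th - pi / 2) a0.
have := stable_moment_phase b th a0.
set u := gammaR a b 0; set v := gammaR a b _; set g := gammaR a 0 0.
have E w : S w `^ (- a) * (g + gammaR a b (th - b * ln (S w))) =
   g * S w `^ (- a) + (u * (S w `^ (- a) * cos (th - b * ln (S w)))
     - v * (S w `^ (- a) * cos (th - pi / 2 - b * ln (S w)))).
  rewrite (gammaR_phase _ _ a0) -/u -/v.
  rewrite (_ : th - pi / 2 - b * ln (S w) = th - b * ln (S w) - pi / 2); last by ring.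
  rewrite cosBpihalf; ring.
have j0 : P.-integrable setT (fun w => (g * S w `^ (- a))%:E) by exact: (integrableZl _ g i0).
have j1 : P.-integrable setT (fun w => (u * (S w `^ (- a) * cos (th - b * ln (S w))))%:E).
  exact: (integrableZl _ u i1).
have j2 : P.-integrable setT (fun w => (v * (S w `^ (- a) * cos (th - pi / 2 - b * ln (S w))))%:E).
  exact: (integrableZl _ v i2).
have j3 : P.-integrable setT (fun w => (u * (S w `^ (- a) * cos (th - b * ln (S w)))
     - v * (S w `^ (- a) * cos (th - pi / 2 - b * ln (S w))))%:E).
  exact: (integrableB _ j1 j2).
under eq_integral do rewrite E.
move/(congr1 fine); rewrite -/(Rintegral _ _ _) RintegralD// RintegralB// !RintegralZl//=.
rewrite {1}/Rintegral stable_moment//= => H.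
have gE : g * (alpha^-1 * (gammaR (a / alpha) 0 0 / g)) = alpha^-1 * gammaR (a / alpha) 0 0.
  by rewrite mulrCA [g * _]mulrC divfK// gt_eqF// gammaR00_gt0.
rewrite gE mulrDr in H; exact: addrI H.
Qed.

(** The real part is the rotated identity at phase 0, the imaginary part the one at phase - pi/2. *)
Lemma stable_mellin (a b : R) : 0 < a ->
  cGamma (a +i* b) *
   ((\int[P]_w (S w `^ (- a) * cos (- (b * ln (S w))))) +i*
    (\int[P]_w (S w `^ (- a) * sin (- (b * ln (S w)))))) =
  (alpha^-1)%:C * cGamma ((a / alpha) +i* (b / alpha)).
Proof.
move=> a0; rewrite !cGammaE.
have H0 := stable_moment_rotated b 0 a0.
have H1 := stable_moment_rotated b (- (pi / 2)) a0.
have E0 : \int[P]_w (S w `^ (- a) * cos (0 - b * ln (S w))) =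
   \int[P]_w (S w `^ (- a) * cos (- (b * ln (S w)))).
  by apply: eq_Rintegral => w _; rewrite sub0r.
have E1 : \int[P]_w (S w `^ (- a) * cos (0 - pi / 2 - b * ln (S w))) =
   \int[P]_w (S w `^ (- a) * sin (- (b * ln (S w)))).
  by apply: eq_Rintegral => w _; rewrite -cosBpihalf sub0r addrC.
have E2 : \int[P]_w (S w `^ (- a) * cos (- (pi / 2) - b * ln (S w))) =
   \int[P]_w (S w `^ (- a) * sin (- (b * ln (S w)))).
  by apply: eq_Rintegral => w _; rewrite -cosBpihalf addrC.
have E3 : \int[P]_w (S w `^ (- a) * cos (- (pi / 2) - pi / 2 - b * ln (S w))) =
   - \int[P]_w (S w `^ (- a) * cos (- (b * ln (S w)))).
  rewrite -[RHS]mulN1r -RintegralZl//; last first.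
    have := integrable_stable_phase b 0 a0.
    by under eq_fun do rewrite sub0r.
  apply: eq_Rintegral => w _.
  rewrite (_ : - (pi / 2) - pi / 2 - b * ln (S w) = - (b * ln (S w) + pi)); last by lra.
  by rewrite !cosN cosDpi mulrN mulN1r.
rewrite E0 E1 in H0; rewrite E2 E3 in H1.
set C := Rintegral _ _ _ in H0 H1 *; set D := Rintegral _ _ _ in H0 H1 *.
apply/eqP; rewrite eq_complex/=; apply/andP; split; apply/eqP.
- by rewrite H0; ring.
- by rewrite mul0r addr0 -H1; ring.
Qed.

End stable_moments.

(** * Size-biasing *)

(** Layer cake: a nonnegative h is the integral over r of the indicator of 0 <= r < h, so by Tonelli
    equal tails give equal integrals. The weight [f] is a density for size-biasing and the constant
    1 for quantiles. *)
Lemma ge0_integral_layer d1 (T1 : measurableType d1) d2 (T2 : measurableType d2)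
    (R : realType) (Q : probability T1 R) (P : probability T2 R)
    (h1 : T1 -> R) (h2 f : T2 -> R) :
    measurable_fun setT h1 -> measurable_fun setT h2 -> measurable_fun setT f ->
    (forall w, 0 <= h1 w) -> (forall w, 0 <= h2 w) -> (forall w, 0 <= f w) ->
    (forall r : R, 0 <= r ->
       Q [set w | r < h1 w] =
       (\int[P]_w (f w * \1_[set w | r < h2 w] w)%:E)%E) ->
  (\int[Q]_w (h1 w)%:E = \int[P]_w (f w * h2 w)%:E)%E.
Proof.
move=> mh1 mh2 mf h10 h20 f0 QP.
pose mu := @lebesgue_measure R.
pose k (y r : R) : R := \1_(`[0%R, y[%classic) r.
have kE y r : k y r = ((0 <= r) && (r < y))%:R.
  by rewrite /k indicE mem_setE in_itv.
have int_k y : 0 <= y -> (\int[mu]_r (k y r)%:E = y%:E)%E.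
  move=> y0; rewrite integral_indic// setIT /mu/= lebesgue_measure_itv/= lte_fin.
  by case: ltgtP y0 => // [_|<-] _; rewrite ?sube0.
have mk d' (T : measurableType d') (X : T -> R) : measurable_fun setT X ->
    measurable_fun [set: T * measurableTypeR R] (fun z => k (X z.1) z.2).
  move=> mX.
  rewrite (_ : (fun z => _) = \1_[set z : T * measurableTypeR R | 0 <= z.2 < X z.1]); last first.
    by apply/funext => z; rewrite kE indicE mem_setE.
  apply: measurable_indic.
  have m1 : measurable_fun [set: T * measurableTypeR R] (fun z => 0 <= z.2 :> R).
    by apply: measurable_fun_ler => //; exact: measurable_snd.
  have m2 : measurable_fun [set: T * measurableTypeR R] (fun z => z.2 < X z.1 :> R).
    apply: measurable_fun_ltr; first exact: measurable_snd.
    exact: (measurableT_comp mX measurable_fst).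
  rewrite -[X in measurable X]setTI.
  exact: (measurable_and m1 m2).
have mk1 := mk _ _ _ mh1.
have mk2 := mk _ _ _ mh2.
have k0 y r : 0 <= k y r by rewrite kE ler0n.
transitivity (\int[Q]_w \int[mu]_r (k (h1 w) r)%:E)%E.
  by apply: eq_integral => w _; rewrite int_k.
rewrite (fubini_tonelli (m1 := Q) (m2 := mu) (fun z => (k (h1 z.1) z.2)%:E))//; last 2 first.
- exact/measurable_EFinP.
- by move=> z; rewrite lee_fin.
transitivity (\int[mu]_r \int[P]_w (f w * k (h2 w) r)%:E)%E.
  apply: eq_integral => r _.
  have [r0|r0] := leP 0 r; last first.
    have k00 y : k y r = 0 by rewrite kE leNgt r0.
    under eq_integral do rewrite k00.
    rewrite integral0; under eq_integral do rewrite k00 mulr0.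
    by rewrite integral0.
  have mA : measurable [set w | r < h1 w].
    rewrite -[X in measurable X]setTI.
    exact: (measurable_fun_ltr (measurable_cst r) mh1).
  have k1 d' (T : measurableType d') (h : T -> R) w : k (h w) r = \1_[set w | r < h w] w.
    by rewrite kE indicE mem_setE r0.
  under eq_integral do rewrite k1.
  rewrite integral_indic// setIT /= QP//.
  by apply: eq_integral => w _; rewrite k1.
pose h (z : T2 * measurableTypeR R) := (f z.1 * k (h2 z.1) z.2)%:E.
transitivity (\int[mu]_r \int[P]_w h (w, r))%E; first by [].
rewrite -(fubini_tonelli (m1 := P) (m2 := mu) h); last 2 first.
- apply/measurable_EFinP; apply: measurable_funM => //.
  exact: (measurableT_comp mf measurable_fst).
- by move=> z; rewrite lee_fin mulr_ge0.
apply: eq_integral => w _ /=.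
rewrite /h /=; under eq_integral do rewrite EFinM.
rewrite ge0_integralZl//; last 3 first.
- apply/measurable_EFinP; exact: measurable_indic.
- by move=> r _; rewrite lee_fin.
- by rewrite lee_fin.
by rewrite int_k.
Qed.

Lemma ge0_integral_transfer d1 (T1 : measurableType d1) d2 (T2 : measurableType d2)
    (R : realType) (Q : probability T1 R) (P : probability T2 R)
    (X1 : T1 -> R) (X2 f : T2 -> R) (g : R -> R) :
    measurable_fun setT X1 -> measurable_fun setT X2 -> measurable_fun setT f ->
    (forall w, 0 <= f w) ->
    (forall A : set R, measurable A ->
       Q (X1 @^-1` A) = (\int[P]_w (f w * \1_A (X2 w))%:E)%E) ->
    measurable_fun setT g -> (forall x, 0 <= g x) ->
  (\int[Q]_w (g (X1 w))%:E = \int[P]_w (f w * g (X2 w))%:E)%E.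
Proof.
move=> mX1 mX2 mf f0 QP mg g0.
apply: (@ge0_integral_layer _ T1 _ T2 R Q P (g \o X1) (g \o X2) f) => //.
- exact: measurableT_comp.
- exact: measurableT_comp.
- by move=> w; exact: g0.
- by move=> w; exact: g0.
move=> r r0; rewrite -(QP [set x | r < g x])//.
rewrite -[X in measurable X]setTI.
exact: (measurable_fun_ltr (measurable_cst r) mg).
Qed.

(** A nonnegative weight commutes with positive and negative parts, so the nonnegative case applies
    to each without an integrability assumption. *)
Lemma integral_transfer d1 (T1 : measurableType d1) d2 (T2 : measurableType d2)
    (R : realType) (Q : probability T1 R) (P : probability T2 R)
    (X1 : T1 -> R) (X2 f : T2 -> R) (g : R -> R) :
    measurable_fun setT X1 -> measurable_fun setT X2 -> measurable_fun setT f ->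
    (forall w, 0 <= f w) ->
    (forall A : set R, measurable A ->
       Q (X1 @^-1` A) = (\int[P]_w (f w * \1_A (X2 w))%:E)%E) ->
    measurable_fun setT g ->
  (\int[Q]_w (g (X1 w))%:E = \int[P]_w (f w * g (X2 w))%:E)%E.
Proof.
move=> mX1 mX2 mf f0 QP mg.
rewrite integralE [RHS]integralE; congr (_ - _)%E.
  transitivity (\int[Q]_w (Num.max (g (X1 w)) 0)%:E)%E.
    by apply: eq_integral => x _; rewrite funeposE EFin_max.
  rewrite (ge0_integral_transfer (P := P) (g := fun x => Num.max (g x) 0) mX1 mX2 mf)//.
  - by apply: eq_integral => x _; rewrite funeposE -EFin_max maxr_pMr// mulr0.
  - by apply: measurable_maxr.
  - by move=> x; rewrite le_max lexx orbT.
transitivity (\int[Q]_w (Num.max (- g (X1 w)) 0)%:E)%E.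
  by apply: eq_integral => x _; rewrite funenegE EFin_max.
rewrite (ge0_integral_transfer (P := P) (g := fun x => Num.max (- g x) 0) mX1 mX2 mf)//.
- by apply: eq_integral => x _; rewrite funenegE -EFinN -EFin_max maxr_pMr// mulr0 mulrN.
- by apply: measurable_maxr => //; exact: measurableT_comp.
- by move=> x; rewrite le_max lexx orbT.
Qed.

Section density.
Context d (T : measurableType d) (R : realType) (P : probability T R) (f : T -> R).

(** The proofs are arguments so that the measure and probability instances can be attached to this
    constant. *)
Definition density_prob (mf : measurable_fun setT f) (f0 : forall x, 0 <= f x)
    (f1 : (\int[P]_x (f x)%:E = 1)%E) : set T -> \bar R :=
  fun A => (\int[P]_(x in A) (f x)%:E)%E.

Context (mf : measurable_fun setT f) (f0 : forall x, 0 <= f x)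
  (f1 : (\int[P]_x (f x)%:E = 1)%E).
Local Notation Q := (density_prob mf f0 f1).

Let Q0 : Q set0 = 0%E.
Proof. by rewrite /density_prob integral_set0. Qed.

Let Q_ge0 A : (0 <= Q A)%E.
Proof. by apply: integral_ge0 => x _; rewrite lee_fin. Qed.

Let Q_sigma_additive : semi_sigma_additive Q.
Proof.
move=> /= F mF tF mUF; rewrite /density_prob; apply: cvg_toP.
  apply: ereal_nondecreasing_is_cvgn => m n mn.
  apply: lee_sum_nneg_natr => // k _ _.
  by apply: integral_ge0 => /= x Fkx; rewrite lee_fin.
rewrite ge0_integral_bigcup//=.
- by apply/measurable_EFinP; exact: measurable_funTS.
- by move=> x _; rewrite lee_fin.
Qed.

HB.instance Definition _ := isMeasure.Build _ _ _ Q Q0 Q_ge0 Q_sigma_additive.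

Let Q1 : Q setT = 1%E.
Proof. exact: f1. Qed.

HB.instance Definition _ := @Measure_isProbability.Build _ _ R Q Q1.

End density.

Section size_bias.
Context d (T : measurableType d) (R : realType) (P : probability T R)
  (Y : T -> R) (m : R).
Hypotheses (mY : measurable_fun setT Y) (Y0 : forall w, 0 <= Y w)
  (m0 : 0 < m) (EY : (\int[P]_w (Y w)%:E = m%:E)%E).

Lemma expectation_size_bias (A : set R) : measurable A ->
  ('E_P[(fun w => Y w * \1_(Y @^-1` A) w)%R] / 'E_P[Y] =
   \int[P]_w (m^-1 * Y w * \1_A (Y w))%:E)%E.
Proof.
move=> mA; rewrite unlock EY inver gt_eqF// muleC -ge0_integralZl//; last 3 first.
- apply/measurable_EFinP; apply: measurable_funM => //; apply: measurable_indic.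
  by rewrite -[X in measurable X]setTI; exact: mY.
- by move=> w _; rewrite lee_fin mulr_ge0.
- by rewrite lee_fin invr_ge0 ltW.
by apply: eq_integral => w _; rewrite -EFinM mulrA.
Qed.

Section biased_variable.
Context d' (T' : measurableType d') (P' : probability T' R) (W : {RV P' >-> R}).
Hypothesis sbW : size_biased P Y W.

(** Size-biasing prescribes the law on subsets of [0, +oo[ only. Intersecting [A] with this
    half-line changes neither side, because [W] is positive almost everywhere and [Y] is
    nonnegative. *)
Lemma size_biased_law (A : set R) : measurable A ->
  P' (W @^-1` A) = (\int[P]_w (m^-1 * Y w * \1_A (Y w))%:E)%E.
Proof.
move=> mA; pose B := A `&` [set` `[0%R, +oo[].
have mB : measurable B by exact: measurableI.
transitivity (\int[P]_w (m^-1 * Y w * \1_B (Y w))%:E)%E; last first.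
  apply: eq_integral => w _; congr (_ * _)%:E.
  by rewrite /B indicI /= [X in _ * X]indicE mem_set ?mulr1//= in_itv/= Y0.
rewrite -expectation_size_bias// -(sbW.2 B mB); last by move=> x [].
rewrite /distribution/= /pushforward.
have mW (C : set R) : measurable C -> measurable (W @^-1` C).
  by move=> mC; rewrite -[X in measurable X]setTI; exact: measurable_funPT.
have [N [mN PN0 sN]] := sbW.1.
apply/eqP; rewrite eq_le; apply/andP; split; last first.
  by apply: le_measure; rewrite ?inE; [exact: mW|exact: mW|move=> w []].
apply: (@le_trans _ _ (P' ((W @^-1` B) `|` N))).
  apply: le_measure; rewrite ?inE; [exact: mW|exact: measurableU (mW _ mB) mN|].
  move=> w Aw; have [Wp|Wn] := ltP 0 (W w).
    by left; split => //=; rewrite in_itv/= ltW.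
  by right; apply: sN => /=; rewrite ltNge Wn.
by apply: le_trans (measureU2 _ _ _) _ => //; [exact: mW|rewrite /= PN0 adde0].
Qed.

Lemma size_biased_integral (g : R -> R) : measurable_fun setT g ->
  (\int[P']_w (g (W w))%:E = \int[P]_w (m^-1 * Y w * g (Y w))%:E)%E.
Proof.
move=> mg; apply: integral_transfer => //.
- exact: measurable_funM.
- by move=> w; rewrite mulr_ge0// invr_ge0 ltW.
- exact: size_biased_law.
Qed.

End biased_variable.

(** Take [Y] itself as the variable, under the probability of density Y/m. *)
Lemma size_biased_exists : {ae P, forall w, 0 < Y w} ->
  exists (d' : measure_display) (T' : measurableType d') (P' : probability T' R)
    (W : {RV P' >-> R}), size_biased P Y W.
Proof.
move=> Ypos; pose f w := m^-1 * Y w.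
have mf : measurable_fun setT f by exact: measurable_funM.
have f0 w : 0 <= f w by rewrite mulr_ge0// invr_ge0 ltW.
have f1 : (\int[P]_w (f w)%:E = 1)%E.
  under eq_integral do rewrite /f EFinM.
  rewrite ge0_integralZl//; last 3 first.
  - exact/measurable_EFinP.
  - by move=> w _; rewrite lee_fin.
  - by rewrite lee_fin invr_ge0 ltW.
  by rewrite EY -EFinM mulVf// gt_eqF.
pose Q : probability T R := density_prob mf f0 f1.
pose W : {mfun T >-> R} := mfun_Sub (mem_set mY).
exists d, T, Q, W; split.
  have [N [mN PN0 sN]] := Ypos.
  exists N; split => //; apply: null_set_integral => //.
  by apply/measurable_EFinP; exact: measurable_funTS.
move=> A mA _; rewrite expectation_size_bias// /distribution/= /pushforward/= /density_prob.
rewrite integral_mkcond; apply: eq_integral => w _.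
rewrite patchE; case: ifPn => wA.
  by rewrite indicE mem_set ?mulr1//; rewrite inE in wA.
by rewrite indicE memNset ?mulr0//; rewrite notin_setE in wA.
Qed.

End size_bias.

(** * The function Phi *)

Lemma cGamma_neq0 (R : realType) (a b : R) : 0 < a -> cGamma (a +i* b) != 0.
Proof.
move=> a0; rewrite cGammaE; apply/eqP => /eqP; rewrite eq_complex/= => /andP[/eqP u0 /eqP v0].
have := gamma_ratio_gt0 b a0.
by rewrite /gamma_ratio /gamma_sq u0 v0 expr0n/= addr0 mul0r ltxx.
Qed.

Lemma cexp_phase (R : realType) (x : R) : cexp (0 +i* x) = cos x +i* sin x.
Proof. by rewrite /cexp/= expR0 mul1r. Qed.

Lemma cexp_phaseD (R : realType) (x y : R) :
  cexp (0 +i* (x + y)) = cexp (0 +i* x) * cexp (0 +i* y).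
Proof.
rewrite !cexp_phase cosD sinD; apply/eqP; rewrite eq_complex/=.
by apply/andP; split; apply/eqP; ring.
Qed.

Lemma cexp_phase_neq0 (R : realType) (x : R) : cexp (0 +i* x) != 0.
Proof.
rewrite cexp_phase; apply/eqP => /eqP; rewrite eq_complex/= => /andP[/eqP u0 /eqP v0].
have := cos2Dsin2 x; rewrite u0 v0 expr0n/= addr0 => /eqP.
by rewrite eq_sym oner_eq0.
Qed.

Lemma realC_neq0 (R : realType) (c : R) : (c%:C != 0 :> R[i]) = (c != 0).
Proof. by rewrite eq_complex/= eqxx andbT. Qed.

Lemma div_realC (R : realType) (x y c : R) : c != 0 ->
  (x +i* y) / c%:C = (x / c) +i* (y / c).
Proof.
move=> c0; apply: (@mulIf _ c%:C); first by rewrite realC_neq0.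
rewrite divfK ?realC_neq0//; apply/eqP; rewrite eq_complex/=.
by rewrite !mulr0 subr0 add0r !divfK// !eqxx.
Qed.

Lemma cpow2_phase (R : realType) (t c : R) : c != 0 ->
  cpow 2 ((0 +i* t) / c%:C) = cexp (0 +i* (t / c * ln 2)).
Proof.
move=> c0; rewrite /cpow div_realC// mul0r; congr cexp.
by apply/eqP; rewrite eq_complex/= !mul0r mulr0 subr0 add0r !eqxx.
Qed.

Lemma PhiE (R : realType) (p q t : R) : 0 < p -> 0 < q ->
  Phi p q t = cexp (0 +i* (t * ((1 / p - 1 / q) * ln 2))) *
   ((cGamma ((1 / p) +i* (t / p)) * (gammaR (1 / q) 0 0)%:C) /
    (cGamma ((1 / q) +i* (t / q)) * (gammaR (1 / p) 0 0)%:C)).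
Proof.
move=> p0 q0; have pn0 := lt0r_neq0 p0; have qn0 := lt0r_neq0 q0.
rewrite /Phi !cpow2_phase// !(div_realC 1 t)//.
have rE (c : R) : c != 0 -> 1 / c%:C = (1 / c)%:C.
  by move=> c0; rewrite -[1 in LHS]/(1%:C) div_realC// mul0r.
rewrite !rE// !cGamma_real.
rewrite (_ : t / p * ln 2 = t * ((1 / p - 1 / q) * ln 2) + t / q * ln 2); last by ring.
rewrite cexp_phaseD; have := cexp_phase_neq0 (t / q * ln 2).
have := @cGamma_neq0 R (1 / q) (t / q) (divr_gt0 ltr01 q0).
have : (gammaR (1 / p) 0 0)%:C != 0 :> R[i].
  by rewrite realC_neq0 gt_eqF// gammaR00_gt0 ?divr_gt0.
move: (cexp _) (cexp _) (cGamma _) (cGamma _) (_%:C) (_%:C) => e1 e2 g1 g2 r1 r2.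
by move=> r2n g2n e2n; field; rewrite r2n g2n e2n.
Qed.

Lemma Phi_refl (R : realType) (p t : R) : 0 < p -> Phi p p t = 1.
Proof.
move=> p0; have p10 : 0 < 1 / p by rewrite divr_gt0.
rewrite PhiE// subrr mul0r mulr0 cexp_phase cos0 sin0 divff; first by rewrite mulr1.
apply: mulf_neq0; first exact: cGamma_neq0.
by rewrite realC_neq0 gt_eqF// gammaR00_gt0.
Qed.

Lemma charfunE d (T : measurableType d) (R : realType) (P : probability T R)
    (X : T -> R) (t : R) :
  charfun P X t = (\int[P]_w cos (t * X w)) +i* (\int[P]_w sin (t * X w)).
Proof.
by rewrite /charfun /cintegral; congr (_ +i* _); apply: eq_Rintegral => w _;
  rewrite cexp_phase.
Qed.

Definition normsq (R : realType) (z : R[i]) : R :=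
  complex.Re z ^+ 2 + complex.Im z ^+ 2.

Lemma normsqM (R : realType) (y z : R[i]) : normsq (y * z) = normsq y * normsq z.
Proof. by case: y => a b; case: z => c e; rewrite /normsq/=; ring. Qed.

Lemma normsq_charfun d (T : measurableType d) (R : realType) (P : probability T R)
    (X : {RV P >-> R}) (t : R) : normsq (charfun P X t) <= 1.
Proof.
rewrite charfunE /normsq/=.
have i1 : P.-integrable setT (EFin \o cst (1 : R)).
  by apply: finite_measure_integrable_cst.
have := @sqr_phase_integral_le _ T R P setT (cst 1) (fun w => t * X w) measurableT
  (fun _ _ => ler01) i1 (measurable_funM (measurable_cst _) (measurable_funPT X)).
rewrite [X in _ <= X -> _](_ : _ = 1); last first.
  by rewrite Rintegral_cst//= probability_setT mulr1 expr1n.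
by congr (_ ^+ 2 + _ ^+ 2 <= _); apply: eq_Rintegral => w _; rewrite mul1r.
Qed.

(** At t = 1 both Gamma arguments lie on the diagonal b = a, so |Phi(1)|^2 is the quotient of the
    Gamma ratios at 1/p and 1/q. Strict decrease along the diagonal makes it exceed 1. *)
Lemma not_charfun_Phi (R : realType) (p q : R) : 0 < q -> q < p ->
  ~ is_charfun (Phi p q).
Proof.
move=> q0 qp [d [T [P [X XP]]]]; have p0 := lt_trans q0 qp.
have p10 : 0 < 1 / p by rewrite divr_gt0.
have q10 : 0 < 1 / q by rewrite divr_gt0.
have pq : 1 / p < 1 / q by rewrite !div1r ltf_pV2.
have Gp := gammaR00_gt0 p10; have Gq := gammaR00_gt0 q10.
have := normsq_charfun X 1; rewrite XP leNgt => /negP; apply.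
have := gamma_ratio_lt p10 pq.
have E : normsq (Phi p q 1) *
   (normsq (cGamma ((1 / q) +i* (1 / q))) * normsq (gammaR (1 / p) 0 0)%:C) =
   normsq (cGamma ((1 / p) +i* (1 / p))) * normsq (gammaR (1 / q) 0 0)%:C.
  rewrite PhiE// normsqM cexp_phase {1}/normsq/= cos2Dsin2 mul1r -!normsqM divfK//.
  apply: mulf_neq0; first exact: cGamma_neq0.
  by rewrite realC_neq0 gt_eqF.
have S (a b : R) : normsq (cGamma (a +i* b)) = gamma_sq a b by rewrite cGammaE.
have S' (a : R) : normsq a%:C = a ^+ 2 by rewrite /normsq/= expr0n addr0.
rewrite 2!S 2!S' in E.
have sq0 : 0 < gamma_sq (1 / q) (1 / q).
  have := gamma_ratio_gt0 (1 / q) q10; rewrite /gamma_ratio pmulr_lgt0// invr_gt0 exprn_gt0//.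
rewrite /gamma_ratio ltr_pdivrMr ?exprn_gt0// mulrAC -E ltr_pdivlMr ?exprn_gt0//.
by rewrite mulrA ltr_pM2r ?exprn_gt0// -[X in X < _]mul1r ltr_pM2r.
Qed.

(** * Existence of positive stable variables *)

(** For Y = e^-X the moment of order u is the Laplace transform of X at u, and sums of independent X
    become products. The value Y = 0 stands for X = +oo, so no mass is lost in limits. *)
Definition unit_moments (R : realType) (phi : R -> R) : Prop :=
  exists (d : measure_display) (T : measurableType d) (P : probability T R)
    (Y : T -> R),
  [/\ measurable_fun setT Y, (forall w, 0 <= Y w <= 1) &
      forall u : R, 0 < u -> (\int[P]_w (Y w `^ u)%:E = (phi u)%:E)%E].

Lemma unit_momentsM (R : realType) (phi psi : R -> R) :
  unit_moments phi -> unit_moments psi -> unit_moments (fun u => phi u * psi u).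
Proof.
move=> [d1 [T1 [P1 [Y1 [mY1 Y101 E1]]]]] [d2 [T2 [P2 [Y2 [mY2 Y201 E2]]]]].
exists (d1, d2).-prod%mdisp, (T1 * T2)%type, (P1 \x P2)%E, (fun z => Y1 z.1 * Y2 z.2).
have Y10 w : 0 <= Y1 w by have /andP[] := Y101 w.
have Y20 w : 0 <= Y2 w by have /andP[] := Y201 w.
have m1 : measurable_fun setT (fun z : T1 * T2 => Y1 z.1).
  exact: (measurableT_comp mY1 measurable_fst).
have m2 : measurable_fun setT (fun z : T1 * T2 => Y2 z.2).
  exact: (measurableT_comp mY2 measurable_snd).
split; first exact: measurable_funM.
  move=> z; rewrite mulr_ge0//=; have /andP[_ a1] := Y101 z.1; have /andP[_ a2] := Y201 z.2.
  by rewrite mulr_ile1.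
move=> u u0.
have mp d (T : measurableType d) (X : T -> R) : measurable_fun setT X ->
    measurable_fun setT (fun w => X w `^ u).
  by move=> mX; exact: (measurableT_comp (measurable_powR u) mX).
under eq_integral do rewrite powRM//.
pose f (z : T1 * T2) := (Y1 z.1 `^ u * Y2 z.2 `^ u)%:E.
rewrite (fubini_tonelli1 (m1 := P1) (m2 := P2) f); last 2 first.
- by apply/measurable_EFinP; apply: measurable_funM; exact: mp.
- by move=> z; rewrite lee_fin mulr_ge0 ?powR_ge0.
transitivity (\int[P1]_x (psi u * Y1 x `^ u)%:E)%E.
  apply: eq_integral => x _; rewrite /fubini_F /f/=.
  under eq_integral do rewrite EFinM.
  rewrite ge0_integralZl//; last 3 first.
  - by apply/measurable_EFinP; exact: mp.
  - by move=> y _; rewrite lee_fin powR_ge0.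
  - by rewrite lee_fin powR_ge0.
  by rewrite E2// -EFinM mulrC.
have psi0 : 0 <= psi u.
  by rewrite -lee_fin -E2//; apply: integral_ge0 => y _; rewrite lee_fin powR_ge0.
under eq_integral do rewrite EFinM.
rewrite ge0_integralZl//; last 2 first.
- by apply/measurable_EFinP; exact: mp.
- by move=> x _; rewrite lee_fin powR_ge0.
by rewrite E1// -EFinM mulrC.
Qed.

Lemma unit_momentsX (R : realType) (phi : R -> R) (n : nat) :
  unit_moments phi -> unit_moments (fun u => phi u ^+ n.+1).
Proof.
move=> H; elim: n => [|n IH]; first by under eq_fun do rewrite expr1.
by under eq_fun do rewrite exprS; exact: unit_momentsM.
Qed.

Lemma powR_lt_powRV (R : realType) (r y u : R) : 0 < u -> 0 <= r -> 0 <= y ->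
  (r < y `^ u) = (r `^ u^-1 < y).
Proof.
move=> u0 r0 y0; have v0 : 0 < u^-1 by rewrite invr_gt0.
apply/idP/idP => H.
  have := gt0_ltr_powR v0 _ _ H; rewrite -powRrM mulfV ?gt_eqF// powRr1//.
  by apply; rewrite nnegrE ?powR_ge0.
have := gt0_ltr_powR u0 _ _ H; rewrite -powRrM mulVf ?gt_eqF// powRr1//.
by apply; rewrite nnegrE ?powR_ge0.
Qed.

(** * Quantile functions of variables with values in [0, 1] *)

Section quantile.
Context d (T : measurableType d) (R : realType) (P : probability T R) (Y : T -> R).
Hypotheses (mY : measurable_fun setT Y) (Y01 : forall w, 0 <= Y w <= 1).

Let F (x : R) : R := fine (P [set w | Y w <= x]).

Let mle (x : R) : measurable [set w | Y w <= x].
Proof.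
rewrite -[X in measurable X]setTI.
exact: (measurable_fun_ler mY (measurable_cst x)).
Qed.

Let FE x : P [set w | Y w <= x] = (F x)%:E.
Proof. by rewrite /F fineK// fin_num_measure. Qed.

Let F_nd : {homo F : x y / x <= y}.
Proof.
move=> x y xy; rewrite -lee_fin -!FE; apply: le_measure; rewrite ?inE//.
by move=> w /= /le_trans; apply.
Qed.

Let F01 x : 0 <= F x <= 1.
Proof. by rewrite -!lee_fin -FE measure_ge0 probability_le1. Qed.

(** Right-continuity of the distribution function, from continuity of [P] along the decreasing
    events Y <= r + 1/(n+1). *)
Let F_right (r w : R) : (forall s, r < s -> w <= F s) -> w <= F r.
Proof.
move=> H.
have cv : P [set t | Y t <= r + n.+1%:R^-1] @[n --> \oo] --> P [set t | Y t <= r].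
  rewrite (_ : [set t | Y t <= r] = \bigcap_n [set t | Y t <= r + n.+1%:R^-1]); last first.
    apply/seteqP; split => [t /= tr n _ /=|t /= tr].
      by apply: le_trans tr _; rewrite lerDl.
    apply/ler_addgt0Pr => e e0.
    have [n ne] : exists n : nat, n.+1%:R^-1 < e.
      by have [n] := ltr_add_invr (e0 : 0 < e); rewrite add0r => ?; exists n.
    by apply: le_trans (tr n Logic.I) _; rewrite lerD2l ltW.
  apply: nonincreasing_cvg_mu => //.
  - by rewrite -ge0_fin_numE ?fin_num_measure.
  - exact: bigcapT_measurable.
  - move=> m n mn; apply/subsetPset => t /= /le_trans; apply.
    by rewrite lerD2l lef_pV2 ?posrE// ler_nat ltnS.
rewrite -lee_fin -FE; move/cvg_lim : (cv) => <- //.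
apply: lime_ge; first by apply/cvg_ex; eexists; exact: cv.
by apply: nearW => n; rewrite FE lee_fin H// ltrDl.
Qed.

(* The disjunct [1 <= x] keeps the set nonempty when [w > 1], where [inf] would
   otherwise be 0 and monotonicity would fail. *)
Definition quantile (w : R) : R :=
  inf [set x | 0 <= x /\ (w <= F x \/ 1 <= x)].

Let quantile_set1 w : [set x | 0 <= x /\ (w <= F x \/ 1 <= x)] 1.
Proof. by split => //; right. Qed.

Let quantile_has_inf w : has_inf [set x | 0 <= x /\ (w <= F x \/ 1 <= x)].
Proof. by split; [exists 1; exact: quantile_set1|exists 0 => x []]. Qed.

Lemma quantile01 w : 0 <= quantile w <= 1.
Proof.
apply/andP; split.
  by apply: lb_le_inf => [|x []//]; exists 1; exact: quantile_set1.
by apply: ge_inf; [case: (quantile_has_inf w)|exact: quantile_set1].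
Qed.

Lemma quantile_nd : {homo quantile : v w / v <= w}.
Proof.
move=> v w vw; apply: lb_le_inf; first by exists 1; exact: quantile_set1.
move=> x [x0 wx]; apply: ge_inf; first by case: (quantile_has_inf v).
by split => //; case: wx => [/(le_trans vw)|]; [left|right].
Qed.

(** The Galois connection between quantile and distribution function. It needs s < 1 because the
    disjunct 1 <= x puts every x >= 1 in the set. *)
Let quantile_leP w s : 0 <= s -> s < 1 -> (quantile w <= s) = (w <= F s).
Proof.
move=> s0 s1; apply/idP/idP => H; last first.
  by apply: ge_inf; [case: (quantile_has_inf w)|split => //; left].
(* Capping r at (s+1)/2 < 1 excludes the disjunct 1 <= x for points of the set below r'. *)
apply: F_right => r sr; pose r' := Num.min r ((s + 1) / 2).
have sr' : s < r' by rewrite lt_min sr/=; lra.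
have r'1 : r' < 1 by rewrite gt_min; apply/orP; right; lra.
have r's : 0 < r' - s by rewrite subr_gt0.
have [x [x0 wx] xs] := inf_adherent r's (quantile_has_inf w).
have xr : x < r' by apply: lt_le_trans xs _; rewrite -/(quantile w); lra.
case: wx => [wx|].
  apply: le_trans wx (F_nd _); apply: le_trans (ltW xr) _.
  by rewrite ge_min lexx.
by move=> x1; have := lt_trans xr r'1; rewrite ltNge x1.
Qed.

(** By the Galois connection the set where the quantile exceeds s < 1 meets [0, 1] in ]F s, 1], of
    length P(Y > s). For s >= 1 both tails are empty. Equal tails give equal moments. *)
Lemma integral_quantile (u : R) : 0 < u ->
  (\int[@lebesgue_measure R]_(w in `[0%R, 1%R]) (quantile w `^ u)%:E =
   \int[P]_w (Y w `^ u)%:E)%E.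
Proof.
move=> u0.
have mq : measurable_fun setT quantile.
  by apply: nondecreasing_measurable => //; exact: quantile_nd.
have mqu : measurable_fun setT (fun w => quantile w `^ u).
  exact: (measurableT_comp (measurable_powR u) mq).
have Y0 w : 0 <= Y w by have /andP[] := Y01 w.
have q0 w : 0 <= quantile w by have /andP[] := quantile01 w.
transitivity (\int[uniform_prob (@ltr01 R)]_w (quantile w `^ u)%:E)%E.
  rewrite integral_uniform//.
  - by rewrite subr0 invr1 mul1e.
  - exact/measurable_EFinP.
  - by move=> w; rewrite lee_fin powR_ge0.
rewrite (@ge0_integral_layer _ _ _ T R (uniform_prob (@ltr01 R)) P
  (fun w => quantile w `^ u) (fun w => Y w `^ u) (cst 1))//.
- by apply: eq_integral => w _; rewrite mul1r.
- exact: (measurableT_comp (measurable_powR u) mY).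
- by move=> w; rewrite powR_ge0.
- by move=> w; rewrite powR_ge0.
move=> r r0; pose s := r `^ u^-1.
have s0 : 0 <= s by rewrite powR_ge0.
have -> : [set w | r < quantile w `^ u] = [set w | s < quantile w].
  by apply/seteqP; split => w /=; rewrite powR_lt_powRV.
have -> : [set w | r < Y w `^ u] = [set w | s < Y w].
  by apply/seteqP; split => w /=; rewrite powR_lt_powRV.
under eq_integral do rewrite mul1r.
have mYs : measurable [set w | s < Y w].
  rewrite -[X in measurable X]setTI.
  exact: (measurable_fun_ltr (measurable_cst s) mY).
have mqs : measurable [set w | s < quantile w].
  rewrite -[X in measurable X]setTI.
  exact: (measurable_fun_ltr (measurable_cst s) mq).
rewrite integral_indic// setIT /=.
have [s1|s1] := ltP s 1; last first.
  have -> : [set w | s < Y w] = set0.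
    apply/seteqP; split => // w /= sY; have /andP[_ Y1] := Y01 w.
    by have := lt_le_trans sY Y1; rewrite ltNge s1.
  have -> : [set w | s < quantile w] = set0.
    apply/seteqP; split => // w /= sY; have /andP[_ Y1] := quantile01 w.
    by have := lt_le_trans sY Y1; rewrite ltNge s1.
  by rewrite !measure0.
have -> : P [set w | s < Y w] = (1 - F s)%:E.
  rewrite EFinB -FE -probability_setC//; congr (P _).
  by apply/seteqP; split => w /=; rewrite ltNge => /negP.
have -> : uniform_prob (@ltr01 R) [set w | s < quantile w] =
    (\int[uniform_prob (@ltr01 R)]_w (\1_[set w | s < quantile w] w)%:E)%E.
  by rewrite integral_indic// setIT.
rewrite integral_uniform//; last first.
  by apply/measurable_EFinP; exact: measurable_indic.
rewrite subr0 invr1 mul1e integral_indic//.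
rewrite (_ : _ `&` _ = `](F s), 1%R]%classic).
  rewrite /= lebesgue_measure_itv/= lte_fin -EFinB; have /andP[_] := F01 s.
  by case: ltgtP => // ->; rewrite subrr.
apply/seteqP; split => w /=; rewrite !in_itv/=.
  by move=> [sq /andP[w0 ->]]; rewrite andbT ltNge -quantile_leP// -ltNge.
move=> /andP[Fw ->]; split; first by rewrite ltNge quantile_leP// -ltNge.
by rewrite andbT (le_trans _ (ltW Fw))//; have /andP[] := F01 s.
Qed.

End quantile.

Lemma unit_moments_monotone (R : realType) (phi : R -> R) : unit_moments phi ->
  exists Q : R -> R, [/\ {homo Q : v w / v <= w}, forall w, 0 <= Q w <= 1 &
    forall u : R, 0 < u ->
      (\int[@lebesgue_measure R]_(w in `[0%R, 1%R]) (Q w `^ u)%:E = (phi u)%:E)%E].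
Proof.
move=> [d [T [P [Y [mY Y01 E]]]]]; exists (quantile P Y); split.
- exact: quantile_nd.
- exact: quantile01.
- by move=> u u0; rewrite integral_quantile// E.
Qed.

(** * Characteristic function of the logarithm of the size-biased variable *)

Section stable_size_bias.
Context (R : realType) (p q : R) d (T : measurableType d) (P : probability T R)
  (S : {RV P >-> R}).
Hypotheses (p0 : 0 < p) (q0 : 0 < q) (stS : positive_stable (p / q) S).
Local Notation Y := (fun w => S w `^ (- (1 / q))).
Local Notation m :=
  ((p / q)^-1 * (gammaR (1 / p) 0 0 / gammaR (1 / q) 0 0)).

Let pq0 : 0 < p / q. Proof. exact: divr_gt0. Qed.
Let q10 : 0 < 1 / q. Proof. exact: divr_gt0. Qed.
Let p10 : 0 < 1 / p. Proof. exact: divr_gt0. Qed.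
Let qpq (x : R) : x / q / (p / q) = x / p.
Proof. by field; rewrite !gt_eqF. Qed.

Lemma measurable_stable_power : measurable_fun setT Y.
Proof. by apply: (measurableT_comp (measurable_powR _)). Qed.

Lemma stable_power_mean_gt0 : 0 < m.
Proof. by rewrite mulr_gt0 ?invr_gt0// divr_gt0// gammaR00_gt0. Qed.

Lemma integral_stable_power : (\int[P]_w (Y w)%:E = m%:E)%E.
Proof. by rewrite (stable_moment pq0 stS q10) qpq. Qed.

Context d' (T' : measurableType d') (P' : probability T' R) (W : {RV P' >-> R}).
Hypothesis sbW : size_biased P Y W.

Lemma ln_Vpq : {ae P', forall w, ln (Vpq p q W w) = (1 / p - 1 / q) * ln 2 + ln (W w)}.
Proof.
apply: filterS sbW.1 => w Ww.
by rewrite /Vpq lnM ?posrE ?powR_gt0// ln_powR.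
Qed.

(** Here [th] stands for cos or sin, which gives the two parts of the characteristic function at
    once. *)
Lemma size_biased_phase (th : R -> R) (t : R) : measurable_fun setT th ->
  (\int[P']_w (th (t * ln (Vpq p q W w)))%:E =
   \int[P]_w (m^-1 * Y w *
     th (t * ((1 / p - 1 / q) * ln 2) - t / q * ln (S w)))%:E)%E.
Proof.
move=> mth; pose g x := th (t * ((1 / p - 1 / q) * ln 2 + ln x)).
have mg : measurable_fun setT g.
  apply: (measurableT_comp mth); apply: measurable_funM => //.
  by apply: measurable_funD => //; exact: measurable_ln.
transitivity (\int[P']_w (g (W w))%:E)%E.
  apply: ae_eq_integral => //.
  - apply/measurable_EFinP; apply: (measurableT_comp mth); apply: measurable_funM => //.
    apply: (measurableT_comp (@measurable_ln R)); apply: measurable_funM => //.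
  - apply/measurable_EFinP; apply: (measurableT_comp mg); exact: measurable_funPT.
  - by apply: filterS ln_Vpq => w E _; rewrite /g E.
rewrite (size_biased_integral measurable_stable_power _ stable_power_mean_gt0
  integral_stable_power sbW mg) => [|w]; last exact: powR_ge0.
apply: eq_integral => w _; rewrite /g ln_powR; congr (_ * th _)%:E; ring.
Qed.

(** Size-biasing shifts the Mellin exponent by 1: for Y = S^(-1/q) of mean m, E W^(it) = E Y^(1+it)
    / m, a moment of S of order - (1+it)/q, known from the Mellin identity. *)
Lemma charfun_ln_Vpq (t : R) : charfun P' (fun w => ln (Vpq p q W w)) t = Phi p q t.
Proof.
have i0 : P.-integrable setT (fun w => (Y w * cos (- (t / q * ln (S w))))%:E).
  have := integrable_stable_phase pq0 stS (t / q) 0 q10.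
  by under eq_fun do rewrite sub0r.
have i1 : P.-integrable setT (fun w => (Y w * sin (- (t / q * ln (S w))))%:E).
  have := integrable_stable_phase pq0 stS (t / q) (- (pi / 2)) q10.
  by under eq_fun do rewrite addrC cosBpihalf.
set K := t * ((1 / p - 1 / q) * ln 2).
have j (r s : R) :
   \int[P]_w (m^-1 * Y w * (r * cos (- (t / q * ln (S w))) + s * sin (- (t / q * ln (S w)))))
   = m^-1 * (r * (\int[P]_w (Y w * cos (- (t / q * ln (S w)))))
     + s * (\int[P]_w (Y w * sin (- (t / q * ln (S w)))))).
  have k0 : P.-integrable setT (fun w => (r * (Y w * cos (- (t / q * ln (S w)))))%:E).
    exact: (integrableZl _ r i0).
  have k1 : P.-integrable setT (fun w => (s * (Y w * sin (- (t / q * ln (S w)))))%:E).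
    exact: (integrableZl _ s i1).
  rewrite -!RintegralZl// -RintegralD// -RintegralZl//; last exact: (integrableD _ k0 k1).
  apply: eq_Rintegral => w _; ring.
rewrite charfunE /Rintegral !size_biased_phase//; last 2 first.
- exact: (continuous_measurable_fun (@continuous_sin R)).
- exact: (continuous_measurable_fun (@continuous_cos R)).
rewrite -!/(Rintegral _ _ _) -/K.
have Ecos w : cos (K - t / q * ln (S w)) =
    cos K * cos (- (t / q * ln (S w))) + - sin K * sin (- (t / q * ln (S w))).
  by rewrite cosD mulNr.
have Esin w : sin (K - t / q * ln (S w)) =
    sin K * cos (- (t / q * ln (S w))) + cos K * sin (- (t / q * ln (S w))).
  exact: sinD.
under eq_Rintegral do rewrite Ecos.
under [X in _ +i* X]eq_Rintegral do rewrite Esin.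
rewrite !j.
have := stable_mellin pq0 stS (t / q) q10; rewrite !qpq.
set C := Rintegral _ _ _; set D := Rintegral _ _ _ => mel.
rewrite PhiE// -/K cexp_phase.
have -> : m^-1 * (cos K * C + - sin K * D) +i* (m^-1 * (sin K * C + cos K * D)) =
   (cos K +i* sin K) * ((m^-1)%:C * (C +i* D)).
  by apply/eqP; rewrite eq_complex/=; apply/andP; split; apply/eqP; ring.
congr (_ * _).
have gq : cGamma ((1 / q) +i* (t / q)) != 0 by exact: cGamma_neq0.
have Gp := gammaR00_gt0 p10; have Gq := gammaR00_gt0 q10.
(* Multiplying by the nonzero Gamma((1+it)/q) produces the left side of the Mellin identity. *)
apply: (mulfI gq); rewrite mulrCA mel !mulrA -rmorphM/=.
have -> : ((p / q)^-1 * gammaR (1 / p) 0 0 / gammaR (1 / q) 0 0)^-1 / (p / q) =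
    gammaR (1 / q) 0 0 / gammaR (1 / p) 0 0.
  by move: (gammaR (1 / p) 0 0) (gammaR (1 / q) 0 0) Gp Gq => x y x0 y0; field; rewrite !gt_eqF.
rewrite rmorphM fmorphV/= invfM.
have rp : (gammaR (1 / p) 0 0)%:C != 0 :> R[i] by rewrite realC_neq0 gt_eqF.
move: gq rp; move: (cGamma _) (cGamma _) (_%:C) (_%:C) => g1 g2 r1 r2 g1n r2n.
by field; rewrite ?g1n ?r2n.
Qed.

End stable_size_bias.

(** * Compactness for monotone functions on the unit interval *)

Lemma integral_nd_itv (R : realType) (h : R -> R) (a b : R) :
    {homo h : v w / v <= w} -> (forall w, 0 <= h w <= 1) -> a <= b ->
  (b - a) * h a <= \int[@lebesgue_measure R]_(x in `]a, b]) h x <= (b - a) * h b.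
Proof.
move=> nh h01 ab.
have mh : measurable_fun setT h by apply: nondecreasing_measurable.
have fin : (@lebesgue_measure R `]a, b] < +oo)%E.
  by rewrite /= lebesgue_measure_itv/=; case: ifP => // _; rewrite -EFinB ltry.
have ih : (@lebesgue_measure R).-integrable `]a, b] (EFin \o h).
  apply: measurable_bounded_integrable => //; first exact: measurable_funTS.
  exists 1; split => // M M1 x _; have /andP[h0 h1] := h01 x.
  by rewrite /= ger0_norm// (le_trans h1)// ltW.
have ic k : (@lebesgue_measure R).-integrable `]a, b] (EFin \o cst k).
  apply: measurable_bounded_integrable => //.
  by exists `|k|; split => // M kM x _ /=; exact: ltW.
have cE k : \int[@lebesgue_measure R]_(x in `]a, b]) (cst k x) = (b - a) * k.
  rewrite Rintegral_cst//= lebesgue_measure_itv/= lte_fin mulrC.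
  move: ab; rewrite le_eqVlt => /predU1P[->|->]; last by rewrite -EFinB.
  by rewrite ltxx subrr !mul0r.
rewrite -!cE; apply/andP; split; apply: le_Rintegral => // x /=;
  by rewrite in_itv/= => /andP[ax xb]; apply: nh => //; exact: ltW.
Qed.

(** Left and right sums bracket the integral of a monotone function, and their difference telescopes
    to (h 1 - h 0)/N <= 1/N, a bound independent of [h]. *)
Lemma riemann_sum_nd (R : realType) (h : R -> R) (N : nat) :
    {homo h : v w / v <= w} -> (forall w, 0 <= h w <= 1) -> (0 < N)%N ->
  0 <= (\int[@lebesgue_measure R]_(x in `[0, 1]) h x) -
    N%:R^-1 * \sum_(i < N) h (i%:R / N%:R) <= N%:R^-1.
Proof.
move=> nh h01 N0; pose dl : R := N%:R^-1.
have NR0 : 0 < N%:R :> R by rewrite ltr0n.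
have dl0 : 0 < dl by rewrite invr_gt0.
have mh : measurable_fun setT h by apply: nondecreasing_measurable.
have ih b : (@lebesgue_measure R).-integrable `[0, b] (EFin \o h).
  apply: measurable_bounded_integrable => //; last 2 first.
  - exact: measurable_funTS.
  - exists 1; split => // M M1 x _; have /andP[h0 h1] := h01 x.
    by rewrite /= ger0_norm// (le_trans h1)// ltW.
  by rewrite /= lebesgue_measure_itv/=; case: ifP => // _; rewrite -EFinB ltry.
have H k : dl * \sum_(i < k) h (i%:R * dl) <=
    \int[@lebesgue_measure R]_(x in `[0, k%:R * dl]) h x <=
    dl * \sum_(i < k) h (i.+1%:R * dl).
  elim: k => [|k IH].
    by rewrite mul0r !big_ord0 mulr0 set_itv1 Rintegral_set1 lexx.
  have ab : k%:R * dl <= k.+1%:R * dl by rewrite ler_pM2r// ler_nat.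
  have st := integral_nd_itv nh h01 ab.
  have <- : \int[@lebesgue_measure R]_(x in `[0, k%:R * dl]) h x +
      \int[@lebesgue_measure R]_(x in `]k%:R * dl, k.+1%:R * dl]) h x =
      \int[@lebesgue_measure R]_(x in `[0, k.+1%:R * dl]) h x.
    rewrite -(@Rintegral_itvB _ h (BLeft 0) (BRight (k.+1%:R * dl)) (k%:R * dl))//.
    - by rewrite addrCA subrr addr0.
    - by rewrite bnd_simp mulr_ge0// ltW.
  rewrite !big_ord_recr/= !mulrDr.
  have E : k.+1%:R * dl - k%:R * dl = dl by rewrite -natr1; ring.
  move: IH st; rewrite E => /andP[a1 a2] /andP[b1 b2].
  by rewrite !lerD.
have := H N; rewrite [N%:R * dl]mulfV ?gt_eqF// => /andP[h1 h2].
rewrite subr_ge0 h1/= lerBlDl; apply: (le_trans h2).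
have -> : \sum_(i < N) h (i.+1%:R * dl) = \sum_(i < N) h (i%:R * dl) + (h (N%:R * dl) - h 0).
  rewrite -!(big_mkord xpredT (fun i => h (i%:R * dl))).
  rewrite -(big_mkord xpredT (fun i => h (i.+1%:R * dl))).
  have := @telescope_sumr R 0 N (fun i => h (i%:R * dl)) (leq0n N).
  by rewrite mul0r => <-; rewrite sumrB addrC subrK.
rewrite mulrDr lerD2l ler_piMr ?(ltW dl0)//.
by have /andP[_ a] := h01 (N%:R * dl); have /andP[b _] := h01 0; lra.
Qed.

(** By compactness the image ultrafilter has a cluster point in [0, 1], and a cluster point of an
    ultrafilter is a limit. *)
Lemma ultra_cvg_itv01 (R : realType) (G : set_system nat) (a : nat -> R) :
  UltraFilter G -> (forall n, 0 <= a n <= 1) ->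
  exists2 l : R, 0 <= l <= 1 & a n @[n --> G] --> l.
Proof.
move=> UG a01.
have PF := @ultra_proper _ _ UG.
have [l [/= l01 cl]] := @segment_compact R 0 1 (a @ G) _
  (filterS (fun n _ => a01 n : a n \in `[0, 1]) filterT).
exists l; first by move: l01; rewrite in_itv.
move=> B lB; have [//|nB] := @in_ultra_setVsetC _ G (a @^-1` B) UG.
by have [x [/= nBx Bx]] := cl (~` B) B nB lB.
Qed.

(** Continuity of the power covers a positive limit; at 0 the tolerance e^(1/u) is used directly. *)
Lemma cvg_powR_ge0 (R : realType) (G : set_system nat) (a : nat -> R) (l u : R) :
  Filter G -> 0 < u -> (forall n, 0 <= a n) -> 0 <= l ->
  a n @[n --> G] --> l -> a n `^ u @[n --> G] --> l `^ u.
Proof.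
move=> FG u0 a0; rewrite le_eqVlt => /predU1P[<-|l0] al; last first.
  have C := continuous_powR0y (c := u) l0.
  exact: (@continuous_cvg _ _ _ G FG a (fun y => y `^ u) l C al).
rewrite powR0 ?gt_eqF//; apply/cvgrPdist_lt => e e0.
move/cvgrPdist_lt : al => /(_ (e `^ u^-1)); rewrite powR_gt0// => /(_ isT).
apply: filterS => n; rewrite !sub0r !normrN !ger0_norm ?powR_ge0//.
move=> ane; have := gt0_ltr_powR u0 _ _ ane.
by rewrite -powRrM mulVf ?gt_eqF// powRr1 ?(ltW e0)//; apply; rewrite nnegrE ?powR_ge0.
Qed.

(* Along an ultrafilter every pointwise limit exists; since a Riemann sum with
   [N] nodes approximates the integral of a monotone [0, 1]-valued function
   within [1 / N], uniformly in the function, the integrals converge too. *)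
Lemma monotone_moments_compact (R : realType) (phi_ : nat -> R -> R) (phi : R -> R)
    (Q_ : nat -> R -> R) :
    (forall n, {homo Q_ n : v w / v <= w}) -> (forall n w, 0 <= Q_ n w <= 1) ->
    (forall n (u : R), 0 < u ->
      (\int[@lebesgue_measure R]_(w in `[0%R, 1%R]) (Q_ n w `^ u)%:E = (phi_ n u)%:E)%E) ->
    (forall u : R, 0 < u -> phi_ n u @[n --> \oo] --> phi u) ->
  exists Q : R -> R, [/\ {homo Q : v w / v <= w}, forall w, 0 <= Q w <= 1 &
    forall u : R, 0 < u ->
      (\int[@lebesgue_measure R]_(w in `[0%R, 1%R]) (Q w `^ u)%:E = (phi u)%:E)%E].
Proof.
move=> nQ Q01 EQ cphi.
have [G [UG ooG]] := @ultraFilterLemma nat \oo _.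
have PG := @ultra_proper _ _ UG.
have /choice[Q Qlim] : forall w, exists l : R, (0 <= l <= 1) /\ Q_ n w @[n --> G] --> l.
  by move=> w; have [l] := ultra_cvg_itv01 UG (Q01 ^~ w); exists l.
have Q1 w : 0 <= Q w <= 1 by have [] := Qlim w.
have nQ' : {homo Q : v w / v <= w}.
  move=> v w vw; have [_ cv] := Qlim v; have [_ cw] := Qlim w.
  by apply: (ler_cvg_to cv cw); apply: nearW => n; exact: nQ.
exists Q; split => // u u0.
have pow01 (x : R) : 0 <= x <= 1 -> 0 <= x `^ u <= 1.
  move=> /andP[x0 x1]; have E1 : 1 `^ u = 1 :> R by rewrite powR1.
  rewrite powR_ge0/= -[leRHS]E1.
  by rewrite ge0_ler_powR ?nnegrE// ltW.
have pown (h : R -> R) : {homo h : v w / v <= w} -> (forall w, 0 <= h w <= 1) ->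
    {homo (fun w => h w `^ u) : v w / v <= w}.
  move=> nh h01 v w vw; have /andP[hv _] := h01 v; have /andP[hw _] := h01 w.
  by rewrite ge0_ler_powR ?nnegrE ?(ltW u0)// nh.
pose I := \int[@lebesgue_measure R]_(w in `[0, 1]) (Q w `^ u).
have IE : (\int[@lebesgue_measure R]_(w in `[0%R, 1%R]) (Q w `^ u)%:E = I%:E)%E.
  rewrite /I /Rintegral fineK// ge0_fin_numE; last first.
    by apply: integral_ge0 => w _; rewrite lee_fin powR_ge0.
  apply: (@le_lt_trans _ _ (\int[@lebesgue_measure R]_(w in `[0%R, 1%R]) 1%:E)%E).
    apply: ge0_le_integral => //=.
    - by move=> w _; rewrite lee_fin powR_ge0.
    - apply/measurable_EFinP; apply: measurable_funTS.
      apply: (measurableT_comp (measurable_powR u)).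
      by apply: nondecreasing_measurable.
    - by move=> w _; rewrite lee_fin; have /andP[] := pow01 _ (Q1 w).
  by rewrite integral_cst//= mul1e lebesgue_measure_itv/= lte_fin ltr01 -EFinB ltry.
rewrite IE; congr EFin; apply/eqP; rewrite -subr_eq0 -normr_le0.
apply/ler_addgt0Pr => e e0; rewrite add0r.
pose N := (Num.bound e^-1).+1.
have Ne : N%:R^-1 <= e :> R.
  rewrite -[leRHS]invrK lef_pV2 ?posrE ?invr_gt0//.
  by rewrite ltW// (lt_trans (archi_boundP _)) ?invr_ge0 ?(ltW e0)// ltr_nat.
apply: le_trans Ne.
have R1 := riemann_sum_nd (pown Q nQ' Q1) (fun w => pow01 _ (Q1 w)) (ltn0Sn _ : (0 < N)%N).
have R2 n := riemann_sum_nd (pown _ (nQ n) (Q01 n))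
  (fun w => pow01 _ (Q01 n w)) (ltn0Sn _ : (0 < N)%N).
pose rs (h : R -> R) := N%:R^-1 * \sum_(i < N) h (i%:R / N%:R) `^ u.
have cvrs : rs (Q_ n) @[n --> G] --> rs Q.
  apply: cvgMr; apply: cvg_big => [|i _]; first exact: add_continuous.
  have [_ cv] := Qlim (i%:R / N%:R).
  apply: cvg_powR_ge0 => // [n|].
    by have /andP[] := Q01 n (i%:R / N%:R).
  by have /andP[] := Q1 (i%:R / N%:R).
have cphiG : phi_ n u @[n --> G] --> phi u.
  by move=> B /(cphi u u0) /ooG.
have R3 n : 0 <= phi_ n u - rs (Q_ n) <= N%:R^-1.
  by have := R2 n; rewrite /Rintegral EQ.
have cd : phi_ n u - rs (Q_ n) @[n --> G] --> phi u - rs Q by exact: cvgB.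
have d0 : 0 <= phi u - rs Q.
  by apply: (cvgr_to_ge cd); apply: nearW => n; have /andP[] := R3 n.
have d1 : phi u - rs Q <= N%:R^-1.
  by apply: (cvgr_to_le cd); apply: nearW => n; have /andP[] := R3 n.
(* Both [I] and [phi u] lie between [rs Q] and [rs Q] + 1/N. *)
move: R1 => /andP[]; rewrite -/I -/(rs Q) => e1 e2.
by rewrite ler_norml; apply/andP; split; lra.
Qed.

(** With y = x_n/(n+1) < 1, exp(- y/(1-y)) <= 1 - y <= exp(- y). Powers of order n+1 squeeze the
    sequence between two exponentials with the same limit. *)
Lemma cvg_compound_exp (R : realType) (x_ : nat -> R) (x : R) :
    (forall n, 0 <= x_ n <= n.+1%:R) -> x_ n @[n --> \oo] --> x ->
  (1 - x_ n / n.+1%:R) ^+ n.+1 @[n --> \oo] --> expR (- x).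
Proof.
move=> x01 cx.
have N0 n : 0 < n.+1%:R :> R by [].
have cy : x_ n / n.+1%:R @[n --> \oo] --> 0.
  by rewrite -[X in _ --> X](mulr0 x); apply: cvgM => //; exact: cvg_harmonic.
have clo : expR (- (x_ n / (1 - x_ n / n.+1%:R))) @[n --> \oo] --> expR (- x).
  apply: (@continuous_cvg _ _ _ _ _ _ expR); first exact: continuous_expR.
  rewrite -[X in _ --> - X]divr1; apply: cvgN; apply: cvgM => //.
  apply: cvgV; first by rewrite oner_neq0.
  by rewrite -[X in _ --> X]subr0; apply: cvgB => //; exact: cvg_cst.
have chi : expR (- x_ n) @[n --> \oo] --> expR (- x).
  by apply: (@continuous_cvg _ _ _ _ _ _ expR); [exact: continuous_expR|exact: cvgN].
apply: (squeeze_cvgr _ clo chi).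
have y1 : \forall n \near \oo, x_ n / n.+1%:R < 1.
  exact: (cvgr_lt _ cy).
near=> n.
have yn1 : x_ n / n.+1%:R < 1 by near: n.
have /andP[xn0 _] := x01 n.
set y := x_ n / n.+1%:R in yn1 *.
have y0 : 0 <= y by rewrite divr_ge0.
have xE : x_ n = n.+1%:R * y by rewrite /y mulrC divfK// gt_eqF.
have z0 : 0 < 1 - y by rewrite subr_gt0.
rewrite xE; apply/andP; split; last first.
  rewrite -[- (n.+1%:R * y)]mulrN expRM_natl lerXn2r ?nnegrE ?expR_ge0 ?(ltW z0)//.
  exact: expR_ge1Dx.
rewrite -mulrA -[- (n.+1%:R * _)]mulrN expRM_natl lerXn2r ?nnegrE ?expR_ge0 ?(ltW z0)//.
rewrite expRN -[leRHS]invrK lef_pV2 ?posrE ?expR_gt0 ?invr_gt0//.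
rewrite [leLHS](_ : _ = 1 + y / (1 - y)); last by field; rewrite gt_eqF.
exact: expR_ge1Dx.
Unshelve. all: by end_near. Qed.

(** * Laplace exponents of truncated Pareto variables *)

Section pareto.
Context (R : realType) (b : R).
Hypothesis b1 : 1 < b.
Local Notation mu := (@lebesgue_measure R).

(* For [v] uniform on [0, N], the variable [v^(-b)] has a Pareto tail of index
   [1 / b]; [lv u] is its Laplace exponent integrand. *)
Let lv (u v : R) : R := 1 - expR (- (u * v `^ (- b))).

Let b0 : 0 < b. Proof. exact: lt_trans b1. Qed.

Let lv01 u v : 0 <= u -> 0 <= lv u v <= 1.
Proof.
move=> u0; rewrite subr_ge0 gerBl expR_ge0 andbT.
by rewrite -[leRHS]expR0 ler_expR oppr_le0 mulr_ge0 ?powR_ge0.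
Qed.

Let mlv u : measurable_fun setT (lv u).
Proof.
apply: measurable_funB => //; apply: measurableT_comp => //; apply: measurableT_comp => //.
by apply: measurable_funM => //; exact: measurable_powR.
Qed.

Let Lam (n : nat) (u : R) : R := \int[mu]_(v in `]0, n.+1%:R]) lv u v.

Let int_lv n u : 0 <= u -> mu.-integrable `]0, n.+1%:R] (EFin \o lv u).
Proof.
move=> u0; apply: measurable_bounded_integrable => //; last 2 first.
- exact: measurable_funTS (mlv _).
- exists 1; split => // M M1 v _ /=; have /andP[h0 h1] := lv01 v u0.
  by rewrite ger0_norm// (le_trans h1)// ltW.
by rewrite /= lebesgue_measure_itv/= lte_fin ltr0n -EFinB ltry.
Qed.

Let mu_itv n : (mu `]0%R, n.+1%:R] = n.+1%:R%:E)%E.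
Proof. by rewrite lebesgue_measure_itv/= lte_fin ltr0n sube0. Qed.

Let unit_moments_pareto n : unit_moments (fun u => 1 - Lam n u / n.+1%:R).
Proof.
have N0 : 0 < n.+1%:R :> R by [].
exists _, _, (uniform_prob N0), (fun v => expR (- (v `^ (- b)))).
have mY : measurable_fun [set: measurableTypeR R] (fun v : R => expR (- (v `^ (- b)))).
  by apply: measurableT_comp => //; apply: measurableT_comp => //; exact: measurable_powR.
split => //.
  by move=> w; rewrite expR_ge0/= -expR0 ler_expR oppr_le0 powR_ge0.
move=> u u0; rewrite integral_uniform//; last first.
  by apply/measurable_EFinP; exact: (measurableT_comp (measurable_powR u) mY).
(* The uniform law lives on a closed interval; dropping the null endpoint 0, where v^(-b) takes a
   default value, gives the domain of [Lam]. *)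
rewrite subr0 -integral_itv_obnd_cbnd; last first.
  apply/measurable_EFinP/measurable_funTS.
  exact: (measurableT_comp (measurable_powR u) mY).
have E v : expR (- (v `^ (- b))) `^ u = 1 - lv u v.
  by rewrite -expRM /lv opprB addrCA subrr addr0 mulNr mulrC.
under eq_integral do rewrite E EFinB.
have i1 : mu.-integrable `]0, n.+1%:R] (EFin \o cst 1).
  apply: measurable_bounded_integrable => //; first by rewrite /= mu_itv ltry.
  by exists 1; split => // M M1 v _ /=; rewrite normr1 ltW.
rewrite integralB//; last exact: int_lv (ltW u0).
rewrite integral_cst//= mul1e mu_itv.
have -> : (\int[mu]_(v in `]0%R, n.+1%:R]) (lv u v)%:E = (Lam n u)%:E)%E.
  rewrite /Lam /Rintegral fineK//.
  exact: (integrable_fin_num _ (int_lv n (ltW u0))).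
by rewrite -EFinB -EFinM mulrBr mulVf ?gt_eqF// mulrC.
Qed.

Let Lam_le n u : 0 <= u -> 0 <= Lam n u <= n.+1%:R.
Proof.
move=> u0; apply/andP; split.
  by apply: Rintegral_ge0 => v _; have /andP[] := lv01 v u0.
have -> : n.+1%:R = \int[mu]_(v in `]0, n.+1%:R]) (cst 1 v) :> R.
  by rewrite Rintegral_cst//= mu_itv/= mul1r.
apply: le_Rintegral => //.
- exact: int_lv.
- apply: measurable_bounded_integrable => //; first by rewrite /= mu_itv ltry.
  by exists 1; split => // M M1 v _ /=; rewrite normr1 ltW.
- by move=> v _; have /andP[] := lv01 v u0.
Qed.

Let LamE n u : 0 <= u ->
  (\int[mu]_(v in `]0%R, n.+1%:R]) (lv u v)%:E = (Lam n u)%:E)%E.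
Proof.
move=> u0; rewrite /Lam /Rintegral fineK//.
exact: (integrable_fin_num _ (int_lv n u0)).
Qed.

Let Lam_cvg u : 0 <= u ->
  (Lam n u)%:E @[n --> \oo] --> (\int[mu]_(v in `]0%R, +oo[) (lv u v)%:E)%E.
Proof.
move=> u0; under eq_fun do rewrite -LamE//.
have -> : `]0%R, +oo[%classic = \bigcup_n (`]0%R, n.+1%:R]%classic : set R).
  apply/seteqP; split => x /=; rewrite in_itv/=.
    rewrite andbT => x0; exists (Num.bound x) => //=.
    rewrite in_itv/= x0/= ltW// (lt_trans (archi_boundP (ltW x0)))// ltr_nat//.
  by move=> [n _] /=; rewrite in_itv/= => /andP[->].
apply: (@ge0_nondecreasing_set_cvg_integral _ (measurableTypeR R) R).
- move=> m n mn; apply/subsetPset; apply: subset_itvl.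
  by rewrite bnd_simp ler_nat ltnS.
- by move=> n; exact: measurable_itv.
- by move=> n; apply/measurable_EFinP; exact: measurable_funTS (mlv _).
- by move=> n v _; rewrite lee_fin; have /andP[] := lv01 v u0.
Qed.

(** The interval ]0, 1] contributes at most 1. Beyond 1 the integrand is at most v^(-b), whose
    integral is at most 1/(b-1) since b > 1. *)
Let Lam1_bound n : Lam n 1 <= 1 + (b - 1)^-1.
Proof.
have bb : 0 < b - 1 by rewrite subr_gt0.
have N1 : (1 : R) <= n.+1%:R by rewrite ler1n.
have -> : Lam n 1 = Lam 0 1 + \int[mu]_(v in `]1, n.+1%:R]) lv 1 v.
  rewrite -(@Rintegral_itvB _ (lv 1) (BRight 0) (BRight n.+1%:R) 1)//;
    [|exact: int_lv|by rewrite bnd_simp].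
  by rewrite /Lam addrCA subrr addr0.
apply: lerD; first by have /andP[] := Lam_le 0 (@ler01 R).
have [->|n0] := eqVneq n 0; first by rewrite set_itvoc0 Rintegral_set0 invr_ge0 ltW.
have N1' : (1 : R) < n.+1%:R by rewrite ltr1n ltnS lt0n.
rewrite -lee_fin.
pose F (v : R) : R := - (b - 1)^-1 * v `^ (1 - b).
have dF (v : R) : 0 < v -> is_derive v 1 F (v `^ (- b)).
  move=> v0; apply: (is_derive_eq (is_derive_mulpowR _ _ v0)).
  rewrite (_ : 1 - b - 1 = - b); last by ring.
  by field; rewrite gt_eqF.
have cf (v : R) : 0 < v -> {for v, continuous (fun v => v `^ (- b))}.
  exact: continuous_powR0y.
have cF (v : R) : 0 < v -> {for v, continuous F}.
  move=> v0; apply: differentiable_continuous; apply/derivable1_diffP.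
  by have [] := dF v v0.
apply: (@le_trans _ _ (\int[mu]_(v in `[1%R, n.+1%:R]) (v `^ (- b))%:E)%E).
  have i1 : mu.-integrable `]1, n.+1%:R] (EFin \o lv 1).
    apply: integrableS (int_lv n (@ler01 R)) => //.
    by apply: subset_itvr; rewrite bnd_simp.
  rewrite /Rintegral fineK ?integrable_fin_num// -integral_itv_obnd_cbnd; last first.
    by apply/measurable_EFinP/measurable_funTS; exact: measurable_powR.
  apply: ge0_le_integral => //=.
  - by move=> v _; rewrite lee_fin; have /andP[] := lv01 v (@ler01 R).
  - by apply/measurable_EFinP; exact: measurable_funTS (mlv _).
  - by apply/measurable_EFinP/measurable_funTS; exact: measurable_powR.
  move=> v _; rewrite lee_fin /lv mul1r.
  by have := expR_ge1Dx (- (v `^ (- b))); lra.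
rewrite (@continuous_FTC2 _ _ F)//.
- rewrite -EFinB lee_fin /F powR1 mulr1 opprK gerDr mulNr oppr_le0 mulr_ge0 ?powR_ge0//.
  by rewrite invr_ge0 ltW.
- apply: continuous_in_subspaceT => v; rewrite inE/= in_itv/= => /andP[v1 _].
  by apply: cf; apply: lt_le_trans v1.
- split.
  + by move=> v; rewrite in_itv/= => /andP[v1 _]; have [] := dF v (lt_trans ltr01 v1).
  + by apply: cvg_at_right_filter; apply: cF.
  + by apply: cvg_at_left_filter; apply: cF.
- move=> v; rewrite in_itv/= => /andP[v1 _]; rewrite derive1E.
  have D := dF v (lt_trans ltr01 v1); exact: derive_val.
Qed.

Let c := fine (\int[mu]_(v in `]0%R, +oo[) (lv 1 v)%:E)%E.

Let cE : (\int[mu]_(v in `]0%R, +oo[) (lv 1 v)%:E = c%:E)%E.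
Proof.
rewrite /c fineK// ge0_fin_numE; last first.
  by apply: integral_ge0 => v _; rewrite lee_fin; have /andP[] := lv01 v (@ler01 R).
apply: (@le_lt_trans _ _ (1 + (b - 1)^-1)%:E); last exact: ltry.
move/cvg_lim : (Lam_cvg (@ler01 R)) => <- //.
apply: lime_le; first by apply/cvg_ex; eexists; exact: (Lam_cvg (@ler01 R)).
by apply: nearW => n; rewrite lee_fin.
Qed.

Let c_gt0 : 0 < c.
Proof.
apply: (@lt_le_trans _ _ (1 - expR (- 1))); first by rewrite subr_gt0 expR_lt1 oppr_lt0.
rewrite -lee_fin -cE.
apply: (@le_trans _ _ (\int[mu]_(v in `]0%R, 1%R]) (lv 1 v)%:E)%E); last first.
  apply: ge0_subset_integral => //=.
  - by apply/measurable_EFinP; exact: measurable_funTS (mlv _).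
  - by move=> v _; rewrite lee_fin; have /andP[] := lv01 v (@ler01 R).
  - by apply: subset_itvl; rewrite bnd_simp.
apply: (@le_trans _ _ (\int[mu]_(v in `]0%R, 1%R]) (1 - expR (- 1))%:E)%E).
  by rewrite integral_cst//= (mu_itv 0) mule1.
apply: ge0_le_integral => //=.
- by apply/measurable_EFinP; exact: measurable_funTS (mlv _).
move=> v; rewrite in_itv/= => /andP[v0 v1]; rewrite lee_fin lerD2l lerN2 ler_expR lerN2 mul1r.
rewrite powRN invf_ge1 ?powR_gt0//.
have E1 : 1 `^ b = 1 :> R by rewrite powR1.
by rewrite -[leRHS]E1 ge0_ler_powR ?nnegrE ?(ltW b0)// ltW.
Qed.

(** The dilation v = u^(1/b) v' turns u v^(-b) into v'^(-b); its Jacobian is the stable exponent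
    u^(1/b). *)
Let lv_scale u : 0 < u ->
  (\int[mu]_(v in `]0%R, +oo[) (lv u v)%:E = (c * u `^ b^-1)%:E)%E.
Proof.
move=> u0; have l0 : 0 < u `^ b^-1 by rewrite powR_gt0.
have clv (v : R) : 0 < v -> {for v, continuous (lv u)}.
  move=> v0; apply: continuousB; first exact: cst_continuous.
  apply: continuous_comp; last exact: continuous_expR.
  apply: continuousN; apply: continuousM; first exact: cst_continuous.
  exact: continuous_powR0y.
rewrite (@powR_substitution_ge0 _ (u `^ b^-1) 1)//; last first.
  by move=> v _; have /andP[] := lv01 v (ltW u0).
rewrite mulrC EFinM -cE -ge0_integralZl//; last 3 first.
- by apply/measurable_EFinP; exact: measurable_funTS (mlv _).
- by move=> v _; rewrite lee_fin; have /andP[] := lv01 v (@ler01 R).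
- by rewrite lee_fin ltW.
apply: eq_integral => v; rewrite inE/= in_itv/= andbT => v0.
rewrite subrr powRr0 !mulr1 powRr1 ?(ltW v0)// -EFinM mulrC; congr (_ * _)%:E.
rewrite /lv mul1r powRM ?(ltW l0) ?(ltW v0)// -powRrM mulrN mulVf ?gt_eqF//.
by rewrite powR_inv1 ?(ltW u0)// mulrA mulfV ?gt_eqF// mul1r.
Qed.

Lemma stable_unit_moments : exists2 c : R, 0 < c &
  exists Q : R -> R, [/\ {homo Q : v w / v <= w}, forall w, 0 <= Q w <= 1 &
    forall u : R, 0 < u ->
      (\int[@lebesgue_measure R]_(w in `[0%R, 1%R]) (Q w `^ u)%:E =
       (expR (- (c * u `^ b^-1)))%:E)%E].
Proof.
exists c; first exact: c_gt0.
have /choice[Q_ Q_P] n := unit_moments_monotone (unit_momentsX n (unit_moments_pareto n)).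
apply: (monotone_moments_compact (Q_ := Q_)
  (phi_ := fun n u => (1 - Lam n u / n.+1%:R) ^+ n.+1)).
- by move=> n; have [] := Q_P n.
- by move=> n; have [] := Q_P n.
- by move=> n; have [] := Q_P n.
move=> u u0; apply: cvg_compound_exp => [n|]; first exact: Lam_le (ltW u0).
have := Lam_cvg (ltW u0); rewrite lv_scale// => /fine_cvgP[_].
exact.
Qed.

End pareto.

(** Take S = - c^(-1/alpha) ln Q under the uniform law, the factor normalizing the constant c to 1.
    It is positive almost everywhere once Q avoids the values 0 and 1, which the moments of small
    and large order show. *)
Lemma positive_stable_exists (R : realType) (alpha : R) : 0 < alpha < 1 ->
  exists (d : measure_display) (T : measurableType d) (P : probability T R)
    (S : {RV P >-> R}), positive_stable alpha S.
Proof.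
move=> /andP[a0 a1]; have b1 : 1 < alpha^-1 by rewrite invf_gt1.
have [c c0 [Q [nQ Q01 EQ]]] := stable_unit_moments b1.
rewrite invrK in EQ.
pose U : probability (measurableTypeR R) R := uniform_prob (@ltr01 R).
have mQ : measurable_fun [set: measurableTypeR R] Q by apply: nondecreasing_measurable.
have mQu u : measurable_fun [set: measurableTypeR R] (fun w => Q w `^ u).
  exact: (measurableT_comp (measurable_powR u) mQ).
have Q0 w : 0 <= Q w by have /andP[] := Q01 w.
have EU u : 0 < u -> (\int[U]_w (Q w `^ u)%:E = (expR (- (c * u `^ alpha)))%:E)%E.
  move=> u0; rewrite /U integral_uniform//.
  - by rewrite subr0 invr1 mul1e EQ.
  - exact/measurable_EFinP.
  - by move=> w; rewrite lee_fin powR_ge0.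
(* Every e^-k with k > 0 is thus a moment of [Q]. *)
have expo k : 0 < k -> exists2 u, 0 < u & c * u `^ alpha = k.
  move=> k0; exists ((k / c) `^ alpha^-1); first by rewrite powR_gt0// divr_gt0.
  rewrite -powRrM mulVf ?gt_eqF// powRr1 ?divr_ge0 ?ltW//.
  by rewrite mulrC divfK ?gt_eqF.
have m1 : measurable [set w : measurableTypeR R | 1 <= Q w].
  rewrite -[X in measurable X]setTI.
  exact: (measurable_fun_ler (f := cst (1 : R)) _ mQ).
have m0 : measurable [set w : measurableTypeR R | Q w <= 0].
  rewrite -[X in measurable X]setTI.
  exact: (measurable_fun_ler (g := cst (0 : R)) mQ _).
have U_indic A : measurable A -> U A = (\int[U]_w (\1_A w)%:E)%E.
  by move=> mA; rewrite integral_indic// setIT.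
have Qu1 u w : 0 < u -> Q w `^ u <= 1.
  move=> u0; have E1 : 1 `^ u = 1 :> R by rewrite powR1.
  by rewrite -[leRHS]E1 ge0_ler_powR ?nnegrE ?(ltW u0)//; have /andP[] := Q01 w.
(* Where Q = 1 every power is 1, so the mass is at most e^(-1/e) <= e for every e > 0. *)
have U1 : U [set w | 1 <= Q w] = 0%E.
  apply/eqP; rewrite eq_le measure_ge0 andbT; apply/lee_addgt0Pr => e e0.
  rewrite add0e; have e10 : 0 < e^-1 by rewrite invr_gt0.
  have [u u0 uk] := expo _ e10.
  apply: (@le_trans _ _ (\int[U]_w (Q w `^ u)%:E)%E).
    rewrite U_indic//; apply: ge0_le_integral => //=.
    - by apply/measurable_EFinP; exact: measurable_indic.
    - exact/measurable_EFinP.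
    move=> w _; rewrite lee_fin indicE; have [wA|_] := boolP (_ \in _); last exact: powR_ge0.
    have Qw1 : 1 <= Q w by move: wA; rewrite inE.
    have -> : Q w = 1.
      by apply/eqP; rewrite eq_le Qw1 andbT; have /andP[] := Q01 w.
    by rewrite powR1.
  rewrite EU// uk lee_fin expRN -[leRHS]invrK lef_pV2 ?posrE ?expR_gt0 ?invr_gt0//.
  by apply: le_trans (expR_ge1Dx _); rewrite lerDr.
(* Where Q = 0 every positive power is 0, so e^-e is at most the mass of the complement; conclude by
   e^-e >= 1 - e. *)
have U0 : U [set w | Q w <= 0] = 0%E.
  apply/eqP; rewrite eq_le measure_ge0 andbT; apply/lee_addgt0Pr => e e0.
  rewrite add0e; have [u u0 uk] := expo e e0.
  have H : ((expR (- e))%:E <= 1 - U [set w | (Q w <= 0)%R])%E.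
    rewrite -probability_setC// -uk -(EU u u0) U_indic; last exact: measurableC.
    apply: ge0_le_integral => //=.
    - by move=> w _; rewrite lee_fin powR_ge0.
    - exact/measurable_EFinP.
    - by apply/measurable_EFinP; apply: measurable_indic; exact: measurableC.
    move=> w _; rewrite lee_fin indicE; have [_|wA] := boolP (_ \in _); first exact: Qu1.
    have Qw0 : Q w <= 0 by move: wA; rewrite notin_setE => /contrapT.
    have -> : Q w = 0 by apply/eqP; rewrite eq_le Qw0 Q0.
    by rewrite powR0// gt_eqF.
  move: H; rewrite -[U _]fineK ?fin_num_measure// -EFinB !lee_fin.
  by have := expR_ge1Dx (- e); lra.
pose S w := - (c `^ (- alpha^-1)) * ln (Q w).
have mS : @measurable_fun _ _ (measurableTypeR R) R setT S.
  by apply: measurable_funM => //; exact: (measurableT_comp (@measurable_ln R) mQ).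
have Qpos : {ae U, forall w, 0 < Q w < 1}.
  exists ([set w | Q w <= 0] `|` [set w | 1 <= Q w]); split.
  - exact: measurableU.
  - apply/eqP; rewrite eq_le measure_ge0 andbT.
    apply: le_trans (measureU2 _ m0 m1) _.
    by rewrite /= U0 U1 adde0.
  - move=> w /= /negP; rewrite negb_and -!leNgt => /orP[]; by [left|right].
pose SX : {mfun measurableTypeR R >-> R} :=
  @mfun_Sub _ _ (measurableTypeR R) R _ (mem_set mS).
exists _, (measurableTypeR R), U, SX; split.
  have [N [mN UN sN]] := Qpos; exists N; split => //.
  apply: subset_trans sN => w /= Sw; apply: contra_not Sw => /andP[w0 w1].
  by rewrite /S mulNr -mulrN mulr_gt0 ?powR_gt0// oppr_gt0 ln_lt0// w0.
move=> u; rewrite le_eqVlt => /predU1P[<-|u0].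
  rewrite powR0 ?gt_eqF// oppr0 expR0 unlock.
  under eq_integral do rewrite mul0r oppr0 expR0.
  by rewrite integral_cst//= probability_setT mule1.
rewrite unlock /=.
have k0 : 0 < u * c `^ (- alpha^-1) by rewrite mulr_gt0// powR_gt0.
transitivity (\int[U]_w (Q w `^ (u * c `^ (- alpha^-1)))%:E)%E.
  apply: ae_eq_integral => //.
  - apply/measurable_EFinP; apply: measurableT_comp => //; apply: measurableT_comp => //.
    exact: measurable_funM.
  - exact/measurable_EFinP.
  - have [N [mN UN sN]] := Qpos; exists N; split => //.
    apply: subset_trans sN => w /= Sw; apply: contra_not Sw => /andP[w0 w1] _.
    by rewrite powR_expR// /S; congr (expR _)%:E; ring.
rewrite EU// powRM ?(ltW u0) ?powR_ge0// -powRrM mulNr mulVf ?gt_eqF//.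
by rewrite powR_inv1 ?(ltW c0)// mulrCA mulfV ?gt_eqF// mulr1.
Qed.

Lemma is_charfun_cst1 (R : realType) (phi : R -> R[i]) :
  (forall t, phi t = 1) -> is_charfun phi.
Proof.
move=> phi1.
have m0 : @measurable_fun _ _ (measurableTypeR R) R setT (cst 0) by exact: measurable_cst.
pose X : {mfun measurableTypeR R >-> R} :=
  @mfun_Sub _ _ (measurableTypeR R) R _ (mem_set m0).
exists _, (measurableTypeR R), (uniform_prob (@ltr01 R)), X => t.
rewrite phi1 charfunE /=.
under eq_Rintegral do rewrite mulr0 cos0.
under [X in _ +i* X]eq_Rintegral do rewrite mulr0 sin0.
by rewrite !Rintegral_cst//= mul0r mul1r probability_setT.
Qed.

(** * Characterization of the pairs for which Phi is a characteristic function *)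

Theorem corollary2 (R : realType) (p q : R) (hp : 0 < p) (hq : 0 < q) :
  [/\ is_charfun (Phi p q) <-> p <= q,
      p < q ->
        (exists (d : measure_display) (T : measurableType d)
                (P : probability T R) (S : {RV P >-> R})
                (d' : measure_display) (T' : measurableType d')
                (P' : probability T' R) (W : {RV P' >-> R}),
           positive_stable (p / q) S /\
           size_biased P (fun w => S w `^ (- (1 / q))) W) /\
        (forall (d : measure_display) (T : measurableType d)
                (P : probability T R) (S : {RV P >-> R}),
           positive_stable (p / q) S ->
           (0 < 'E_P[(fun w => S w `^ (- (1 / q)))%R] < +oo)%E /\
           forall (d' : measure_display) (T' : measurableType d')
                  (P' : probability T' R) (W : {RV P' >-> R}),
             size_biased P (fun w => S w `^ (- (1 / q))) W ->
             {ae P', forall w, ln (Vpq p q W w) =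
                               (1 / p - 1 / q) * ln 2 + ln (W w)} /\
             forall t : R, charfun P' (fun w => ln (Vpq p q W w)) t = Phi p q t)
    & p = q -> forall t : R, Phi p q t = 1].
Proof.
(* Existence of the pair (S, W) serves twice: in the second claim, and to realize Phi when p < q in
   the first. *)
have biased_exists : p < q -> exists (d : measure_display) (T : measurableType d)
    (P : probability T R) (S : {RV P >-> R}) (d' : measure_display)
    (T' : measurableType d') (P' : probability T' R) (W : {RV P' >-> R}),
    positive_stable (p / q) S /\ size_biased P (fun w => S w `^ (- (1 / q))) W.
  move=> pq; have pq01 : 0 < p / q < 1 by rewrite divr_gt0//= ltr_pdivrMr// mul1r.
  have [d [T [P [S stS]]]] := positive_stable_exists pq01.
  exists d, T, P, S.
  have Ypos : {ae P, forall w, 0 < S w `^ (- (1 / q))}.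
    by apply: filterS stS.1 => w Sw; exact: powR_gt0.
  have [d' [T' [P' [W sbW]]]] := size_biased_exists (measurable_stable_power q S)
    (fun w => powR_ge0 _ _) (stable_power_mean_gt0 hp hq)
    (integral_stable_power hp hq stS) Ypos.
  by exists d', T', P', W.
split.
- split => [H|]; first by rewrite leNgt; apply/negP => qp; exact: not_charfun_Phi H.
  rewrite le_eqVlt => /predU1P[<-|pq].
    by apply: is_charfun_cst1 => t; exact: Phi_refl.
  have [d [T [P [S [d' [T' [P' [W [stS sbW]]]]]]]]] := biased_exists pq.
  have mV : measurable_fun setT (fun w => ln (Vpq p q W w)).
    apply: (measurableT_comp (@measurable_ln R)); apply: measurable_funM => //.
  by exists d', T', P', (mfun_Sub (mem_set mV)) => t; exact: (charfun_ln_Vpq hp hq stS sbW t).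
- move=> pq; split; first exact: biased_exists.
  move=> d T P S stS; split.
    rewrite unlock (integral_stable_power hp hq stS).
    by rewrite lte_fin stable_power_mean_gt0//= ltry.
  move=> d' T' P' W sbW; split; first exact: ln_Vpq sbW.
  exact: (charfun_ln_Vpq hp hq stS sbW).
- by move=> <- t; exact: Phi_refl.
Qed.
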